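(* Fix $0<p\leq q\leq\infty$. Let $T:L^p(\mathbb{R}_+)_+ + L^q(\mathbb{R}_+)_+\to S(\mathbb{R}_+)$ be a subconvex operator of Marcinkiewicz weak types $(p,p)$ and $(q,q)$ with constants $C_p,C_q$, i.e. $$\|Tf\|_{L^{r,\infty}(\mathbb{R}_+)}\leq C_r\|f\|_{L^r(\mathbb{R}_+)}\qquad(f\in L^r(\mathbb{R}_+)_+,\ r=p,q).$$ (1) If $E$ is a symmetric quasi-Banach function space on $\mathbb{R}_+$ and either $p<p_E\leq q_E<q<\infty$, or $p<p_E$ and $q=\infty$, then $$\|Tf\|_{E(\mathbb{R}_+)}\leq 2\,\|\Theta_{p,q}\|_{E\to E}\max\{C_p,C_q\}\,\|f\|_{E(\mathbb{R}_+)}\qquad(f\in E(\mathbb{R}_+)_+).$$ (2) If $\Phi$ is an Orlicz function on $\mathbb{R}_+$ satisfying the global $\Delta_2$-condition and either $p<p_\Phi\leq q_\Phi<q<\infty$, or $p<p_\Phi$ and $q=\infty$, then there is a constant $K$ depending only on $\Phi$, $C_p$, $C_q$ (and the fixed $p,q$) such that $$\int_0^\infty\Phi(|Tf(t)|)\,dt\leq K\int_0^\infty\Phi(f(t))\,dt\qquad(f\in(L_\Phi)_+).$$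
   Context: Let $\lambda$ be Lebesgue measure. For a measurable a.e. finite $f$ on $\mathbb{R}_+$ or $\mathbb{R}_+\times\mathbb{R}_+$, $d(v;f)=\lambda(|f|>v)$. $S(\cdot)$ denotes the measurable a.e. finite $f$ with $d(v;f)<\infty$ for some $v>0$; $\mu_t(f)=\inf\{v>0:d(v;f)\le t\}$. $X_+$ denotes the nonnegative elements of $X$. $\|f\|_{L^{r,\infty}}=\sup_{t>0}t^{1/r}\mu_t(f)$ for $r<\infty$ and $L^{\infty,\infty}=L^\infty$. An operator $T:D\to S(\mathbb{R}_+)$ on a convex set $D\subset S(\mathbb{R}_+)$ is subconvex if $T(tf+(1-t)g)\le tT(f)+(1-t)T(g)$ for all $f,g\in D$ and $t\in[0,1]$. A symmetric quasi-Banach function space $E$ on $\mathbb{R}_+$ is a complete quasi-normed linear subspace of $S(\mathbb{R}_+)$ such that $f\in S(\mathbb{R}_+)$, $g\in E$, $\mu(f)\le\mu(g)$ imply $f\in E$ and $\|f\|_E\le\|g\|_E$. $E(\mathbb{R}_+)=E$; $E(\mathbb{R}_+\times\mathbb{R}_+)=\{f\in S(\mathbb{R}_+\times\mathbb{R}_+):\mu(f)\in E\}$ with quasi-norm $\|\mu(f)\|_E$. With $(D_af)(s)=f(as)$ on $E$, the Boyd indices are $p_E=\lim_{s\to\infty}\frac{\log s}{\log\|D_{1/s}\|}$ and $q_E=\lim_{s\downarrow0}\frac{\log s}{\log\|D_{1/s}\|}$ ($=\infty$ if the denominator vanishes). $\Theta_{p,q}f(s,t)=f(s)\theta_{p,q}(t)$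 where $\theta_{p,q}(t)=t^{-1/q}\chi_{(0,1)}(t)+t^{-1/p}\chi_{[1,\infty)}(t)$ ($t^{-1/\infty}=1$); $\|\Theta_{p,q}\|_{E\to E}$ is its operator norm from $E(\mathbb{R}_+)$ to $E(\mathbb{R}_+\times\mathbb{R}_+)$, which is finite under the stated index conditions. An Orlicz function is a convex, continuous, increasing $\Phi:[0,\infty)\to[0,\infty]$ with $\Phi(0)=0$ and $\lim_{t\to\infty}\Phi(t)=\infty$. Global $\Delta_2$-condition: $\Phi(2t)\le C\Phi(t)$ for all $t\ge0$ and some $C>0$. $L_\Phi=\{f\in S(\mathbb{R}_+):\int_0^\infty\Phi(|f|/k)\,dt<\infty\text{ for some }k>0\}$. With $M_\Phi(t)=\sup_{s>0}\Phi(ts)/\Phi(s)$, $p_\Phi=\lim_{t\downarrow0}\frac{\log M_\Phi(t)}{\log t}$ and $q_\Phi=\lim_{t\to\infty}\frac{\log M_\Phi(t)}{\log t}$; these coincide with the Boyd indices of $L_\Phi$.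
   Formalization: Besides T being subconvex, the map f ↦ |Tf| is also assumed subconvex (automatic when T is nonnegative or linear); without this the claim fails for signed T, e.g. a concave functional with negative sign that vanishes on both L^p and L^q but not on their sum. *)

(* Defs.v *)
From HB Require Import structures.
From mathcomp Require Import all_boot all_order all_algebra.
From mathcomp Require Import all_classical all_reals all_analysis.

Set Implicit Arguments.
Unset Strict Implicit.
Unset Printing Implicit Defensive.

Import Order.TTheory GRing.Theory Num.Theory.
Import numFieldNormedType.Exports.

Local Open Scope classical_set_scope.
Local Open Scope ring_scope.

(* The half-line R_+ is the type R carrying the restriction of Lebesgue measure
   to ]0, +oo[, so that values at x <= 0 are irrelevant.  Elements of S(R_+)
   are represented by everywhere finite Borel functions; as every a.e. finite
   measurable function agrees a.e. with one of these, nothing is lost, provided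
   that all notions below are invariant under a.e. equality. *)
Section half_line.
Context {R : realType}.

Definition leb_pos : set (measurableTypeR R) -> \bar R :=
  mrestr (@lebesgue_measure R) (measurable_itv `]0, +oo[).

HB.instance Definition _ := Measure.on leb_pos.

Let leb_pos_sigma_finite : sigma_finite setT leb_pos.
Proof.
have [F TF mF] := sigma_finiteT (@lebesgue_measure R).
exists F => // i; have [mFi Fi] := mF i; split=> //.
rewrite /leb_pos /mrestr (le_lt_trans _ Fi)//.
by apply: le_measure; rewrite ?inE//; apply: measurableI.
Qed.

HB.instance Definition _ :=
  Measure_isSigmaFinite.Build _ _ _ leb_pos leb_pos_sigma_finite.

Definition leb_quadrant :
    {measure set (measurableTypeR R * measurableTypeR R) -> \bar R} :=
  (leb_pos \x leb_pos)%E.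

End half_line.

Section rearrangement.
Context d {X : measurableType d} {R : realType}.
Variable mu : {measure set X -> \bar R}.
Implicit Types f : X -> R.

Definition distr f (v : R) : \bar R := mu [set x | v < `|f x|].

Definition Sfun : set (X -> R) :=
  [set f | measurable_fun setT f /\
           exists v : R, 0 < v /\ (distr f v < +oo)%E].

Definition rearr f (t : R) : \bar R :=
  ereal_inf [set v%:E | v in [set v : R | 0 < v /\ (distr f v <= t%:E)%E]].

(* For f in Sfun and 0 < t, rearr f t is finite. *)
Definition rearr_fun f (t : R) : R := fine (rearr f t).

Definition nonneg : set (X -> R) := [set f | forall x, 0 <= f x].

Definition Lspc (r : \bar R) : set (X -> R) :=
  [set f | measurable_fun setT f /\ ('N[mu]_r[EFin \o f] < +oo)%E].

Definition weakLnorm (r : \bar R) f : \bar R :=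
  match r with
  | r0%:E => ereal_sup [set ((t `^ r0^-1)%:E * rearr f t)%E |
                         t in [set t : R | 0 < t]]
  | _ => 'N[mu]_r[EFin \o f]%E
  end.

Definition sum_cone (p q : \bar R) : set (X -> R) :=
  [set f | exists g h, [/\ (Lspc p `&` nonneg) g, (Lspc q `&` nonneg) h &
                           f = g \+ h]].

(* Subconvexity is a one-sided bound: it does not control the negative part of
   T (t f + (1 - t) g).  For signed T, estimates on |T f| obtained by splitting
   f need subconvexity of f |-> |T f| as well; this is automatic if T is linear
   or if its values are nonnegative. *)
Definition subconvex (D : set (X -> R)) (T : (X -> R) -> (X -> R)) :=
  forall f g (t : R), D f -> D g -> 0 <= t <= 1 ->
    {ae mu, forall x, T (fun y => t * f y + (1 - t) * g y) x <=
                      t * T f x + (1 - t) * T g x}.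

(* T is an operator D -> S; since elements of S are identified when they agree
   a.e., T must respect a.e. equality of representatives. *)
Definition operator_on (D : set (X -> R)) (T : (X -> R) -> (X -> R)) :=
  (forall f, D f -> Sfun (T f)) /\
  (forall f g, D f -> D g -> {ae mu, forall x, f x = g x} ->
     {ae mu, forall x, T f x = T g x}).

Definition weak_type (r : \bar R) (C : R) (T : (X -> R) -> (X -> R)) :=
  forall f, (Lspc r `&` nonneg) f ->
    (weakLnorm r (T f) <= C%:E * 'N[mu]_r[EFin \o f])%E.

End rearrangement.

Section symmetric_spaces.
Context {R : realType}.
Implicit Types (E : set (R -> R)) (N : (R -> R) -> R).

(* N is only meaningful on E. *)
Record symmetric_quasi_banach E N : Prop := {
  sqb_sub : E `<=` Sfun leb_pos ;
  sqb_0 : E (cst 0) ;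
  sqb_add : forall f g, E f -> E g -> E (f \+ g) ;
  sqb_scale : forall (c : R) f, E f -> E (fun x => c * f x) ;
  sqb_norm_ge0 : forall f, E f -> 0 <= N f ;
  sqb_norm_eq0 : forall f, E f ->
    (N f = 0 <-> {ae (@leb_pos R), forall x, f x = 0}) ;
  sqb_norm_scale : forall (c : R) f, E f -> N (fun x => c * f x) = `|c| * N f ;
  sqb_norm_add : exists K : R, forall f g, E f -> E g ->
    N (f \+ g) <= K * (N f + N g) ;
  sqb_complete : forall u : nat -> R -> R, (forall n, E (u n)) ->
    (forall e : R, 0 < e -> exists n0, forall m n,
       (n0 <= m)%N -> (n0 <= n)%N -> N (u m \- u n) < e) ->
    exists2 f, E f & N (u n \- f) @[n --> \oo] --> (0 : R) ;
  sqb_symmetric : forall f g, Sfun leb_pos f -> E g ->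
    (forall t, 0 < t -> (rearr leb_pos f t <= rearr leb_pos g t)%E) ->
    E f /\ N f <= N g
}.

Definition quadrant_space E : set (R * R -> R) :=
  [set F | Sfun leb_quadrant F /\ E (rearr_fun leb_quadrant F)].

Definition quadrant_norm N (F : R * R -> R) : R :=
  N (rearr_fun leb_quadrant F).

(* The infimum of an empty set of reals is 0 by convention, so opnorm is the
   operator norm only for bounded L. *)
Definition opnorm (V W : Type) (A : set V) (NA : V -> R)
    (B : set W) (NB : W -> R) (L : V -> W) : R :=
  inf [set c : R | 0 <= c /\ forall f, A f -> B (L f) /\ NB (L f) <= c * NA f].

Definition dilation (a : R) (f : R -> R) : R -> R := fun s => f (a * s).

Definition boyd_quotient E N (s : R) : \bar R :=
  let l := ln (opnorm E N E N (dilation s^-1)) in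
  if l == 0 then +oo%E else (ln s / l)%:E.

Definition boyd_lower E N : \bar R := lim (boyd_quotient E N s @[s --> +oo]).

Definition boyd_upper E N : \bar R := lim (boyd_quotient E N s @[s --> 0^'+]).

(* (+oo)^-1 = 0, hence t^(-1/q) = 1 when q = +oo. *)
Definition theta (p q : \bar R) (t : R) : R :=
  t `^ (- fine q^-1%E) * \1_(`]0, 1[ : set R) t +
  t `^ (- fine p^-1%E) * \1_(`[1, +oo[ : set R) t.

Definition Theta (p q : \bar R) (f : R -> R) : R * R -> R :=
  fun st => f st.1 * theta p q st.2.

Definition Theta_norm (p q : \bar R) E N : R :=
  opnorm E N (quadrant_space E) (quadrant_norm N) (Theta p q).

End symmetric_spaces.

Section orlicz.
Context {R : realType}.
(* Only the values of Phi on [0, +oo[ are relevant. *)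
Implicit Types Phi : R -> \bar R.

Record orlicz_function Phi : Prop := {
  orlicz_0 : Phi 0 = 0%E ;
  orlicz_ge0 : forall x, 0 <= x -> (0 <= Phi x)%E ;
  orlicz_incr : forall x y, 0 <= x -> x <= y -> (Phi x <= Phi y)%E ;
  orlicz_convex : forall (x y t : R), 0 <= x -> 0 <= y -> 0 <= t <= 1 ->
    (Phi (t * x + (1 - t) * y)%R <= t%:E * Phi x + (1 - t)%:E * Phi y)%E ;
  orlicz_cont : {within `[0, +oo[, continuous Phi} ;
  orlicz_lim : Phi t @[t --> +oo] --> +oo%E
}.

Definition Delta2 Phi :=
  exists C : R, 0 < C /\
    forall t, 0 <= t -> (Phi (2 * t)%R <= C%:E * Phi t)%E.

Definition orlicz_space Phi : set (R -> R) :=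
  [set f | Sfun leb_pos f /\
     exists k : R, 0 < k /\
       (\int[leb_pos]_x Phi (`|f x| / k)%R < +oo)%E].

Definition orlicz_M Phi (t : R) : \bar R :=
  ereal_sup [set (Phi (t * s)%R / Phi s)%E | s in [set s : R | 0 < s]].

Definition orlicz_lower Phi : \bar R :=
  lim ((lne (orlicz_M Phi t) / (ln t)%:E)%E @[t --> 0^'+]).

Definition orlicz_upper Phi : \bar R :=
  lim ((lne (orlicz_M Phi t) / (ln t)%:E)%E @[t --> +oo]).

End orlicz.

(* Main.v *)
Require Import Defs.
From HB Require Import structures.
From mathcomp Require Import all_boot all_order all_algebra.
From mathcomp Require Import all_classical all_reals all_analysis.
From mathcomp Require Import ring lra measurable_realfun ess_sup_inf.
Set Implicit Arguments.
Unset Strict Implicit.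
Unset Printing Implicit Defensive.
Import Order.TTheory GRing.Theory Num.Theory.
Import numFieldNormedType.Exports.
Local Open Scope classical_set_scope.
Local Open Scope ring_scope.

(* Cut f at the height w = v / (2C), C >= Cp, Cq.  Subconvexity applied to
   f = (1/2) (2 f 1_{f > w}) + (1/2) (2 f 1_{f <= w}) and the two weak type
   bounds give
     d(v; Tf) <= \int ((f/w)^p 1_{f > w} + (f/w)^q 1_{f <= w}) = d(w; Theta f),
   the integrand [marc p q (f / w)] being the length of {t | f theta(t) > w}.
   Hence mu(Tf) <= 2C mu(Theta f), which is (1) as soon as Theta is bounded.

   To bound Theta, dominate [marc p q] by jumps at the integer powers b^n of a
   large b.  Then d(w; Theta f) is bounded by a multiple of d(w; g) for every g
   that dominates all the functions b^-n f(. / s_n), for suitable s_n with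
   sum_n b^(np) / s_n finite (with q in place of p for n < 0).  The Boyd indices
   make the norms of these functions decay geometrically, faster than the
   quasi-triangle constant grows if b is large, so such a g exists by
   completeness.

   For (2), \int Phi(|Tf|) is bounded by the sum over the integers k of
   Phi(2^(k+1)) d(2^k; Tf), hence by the integral of
   sum_k Phi(2^(k+1)) marc p q (2C f / 2^k), which the indices of Phi bound
   pointwise by K Phi(f). *)

(** * Affine images of Lebesgue measure *)

(** [N] is only a quasi-norm: it need not be continuous, and no Fatou property is assumed. An
    infinite sum costs a further factor [K] for each term peeled off, which only a geometric decay
    of ratio below [1 / K] can absorb. This is where the strict index inequalities enter. They leave
    room for an exponent [m] between [p] and the lower index (or between the upper index and [q]),
    and this one exponent makes the weights [b^(np) / s_n] summable and the norms of the dilations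
    decay; a large base [b] then beats [K]. In the modular estimate the same room leaves a positive
    power that makes a dyadic sum geometric.

    The factor 2 of the final constant comes from doubling the two parts of [f]. The height [v] is
    not halved: if a midpoint exceeds [v], one of the two endpoints does, so both weak type bounds
    are used at [v] itself. Since [T] may be signed, the midpoint inequality is the one for the
    absolute values of [T].

    Boundedness of [Theta] is a genuine part of the proof: for an unbounded operator [opnorm] would
    be the infimum of an empty set, that is 0. *)

Section lebesgue_affine.
Context {R : realType}.
Notation mu := (@lebesgue_measure R).

(** The pushforward under the translation has the right values on the intervals []a, b]], which
    determine Lebesgue measure. The scaling lemma below argues alike with a rescaled pushforward. *)
Lemma lebesgue_measure_preim_shift (c : R) (A : set R) : measurable A ->
  mu [set x | A (x - c)] = mu A.
Proof.
move=> mA.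
have mf : measurable_fun [set: measurableTypeR R]
  ((fun x => x - c) : measurableTypeR R -> measurableTypeR R).
  by apply: measurable_funB.
rewrite (_ : mu _ = pushforward mu
  ((fun x => x - c) : measurableTypeR R -> measurableTypeR R) A)//.
pose m' : {measure set (measurableTypeR R) -> \bar R} := pushforward mu ((fun x => x - c) : measurableTypeR R -> measurableTypeR R).
apply/esym/(@lebesgue_measure_unique _ (m' mf)) => //= _ [[a b]] _ <-.
rewrite /m' /= /pushforward (_ : _ @^-1` _ = `]a + c, b + c]%classic).
  rewrite !lebesgue_measure_itv/= !lte_fin ltrD2r.
  by case: ifP => // _; rewrite -!EFinD; congr EFin; lra.
by apply/seteqP; split => x /=; rewrite !in_itv/= => /andP[? ?];
  apply/andP; split; lra.
Qed.

Lemma lebesgue_measure_preim_scale (c : R) (A : set R) : 0 < c -> measurable A ->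
  mu [set x | A (c * x)] = (c^-1%:E * mu A)%E.
Proof.
move=> c0 mA.
have mf : measurable_fun [set: measurableTypeR R]
  ((fun x => c * x) : measurableTypeR R -> measurableTypeR R).
  exact: measurable_funM.
pose m1 : {measure set (measurableTypeR R) -> \bar R} := pushforward mu
  ((fun x => c * x) : measurableTypeR R -> measurableTypeR R).
pose m' : {measure set (measurableTypeR R) -> \bar R} := mscale (NngNum (ltW c0)) (m1 mf).
have -> : mu A = m' A.
  apply: (@lebesgue_measure_unique _ m') => //= _ [[a b]] _ <-.
  rewrite /m' /= /mscale /= /m1 /pushforward (_ : _ @^-1` _ = `]c^-1 * a, c^-1 * b]%classic).
    rewrite !lebesgue_measure_itv/= !lte_fin ltr_pM2l ?invr_gt0//.
    case: ifP => // _; rewrite ?mule0// -!EFinD -EFinM; congr EFin.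
    by rewrite -mulrBr mulrA divff ?mul1r// gt_eqF.
  apply/seteqP; split => x /=; rewrite !in_itv/=.
    by rewrite ltr_pdivrMl// ler_pdivlMl.
  by rewrite ltr_pdivrMl// ler_pdivlMl.
by rewrite /m' /mscale/= muleA -EFinM mulVf ?gt_eqF// mul1e.
Qed.

Lemma leb_posE (A : set R) : leb_pos A = mu (A `&` `]0, +oo[).
Proof. by []. Qed.

Lemma leb_pos_itv (c : R) : 0 <= c -> leb_pos `]0, c[%classic = c%:E.
Proof.
move=> c0; rewrite leb_posE setIidl; last first.
  by move=> x /=; rewrite !in_itv/= => /andP[->].
rewrite lebesgue_measure_itv/= lte_fin; case: ltP => [_|c1].
  by rewrite oppr0 adde0.
by congr EFin; apply/eqP; rewrite eq_le c0 c1.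
Qed.

Lemma leb_pos_preim_scale (c : R) (A : set R) : 0 < c -> measurable A ->
  leb_pos [set x | A (c * x)] = (c^-1%:E * leb_pos A)%E.
Proof.
move=> c0 mA; rewrite !leb_posE -lebesgue_measure_preim_scale//; last first.
  by apply: measurableI => //; exact: measurable_itv.
congr (mu _); apply/seteqP; split => x /=; rewrite !in_itv/= !andbT => -[].
  by move=> ? ?; split => //; rewrite mulr_gt0.
by rewrite pmulr_rgt0.
Qed.

End lebesgue_affine.

(** * Distribution functions and rearrangements *)

Lemma lte_dense_fin (R : realFieldType) (t : R) (x : \bar R) : (t%:E < x)%E ->
  exists2 u : R, t < u & (u%:E < x)%E.
Proof.
case: x => [r| |] //; last by move=> _; exists (t + 1); rewrite ?ltrDl// ltry.
by rewrite lte_fin => tr; exists ((t + r) / 2); rewrite ?lte_fin ?midf_lt.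
Qed.

Section distribution.
Context d {X : measurableType d} {R : realType}.
Variable mu : {measure set X -> \bar R}.
Implicit Types f g : X -> R.

Lemma measurable_distr_set f v : measurable_fun setT f ->
  measurable [set x | v < `|f x|].
Proof.
move=> mf; rewrite -[X in measurable X]setTI.
rewrite -(preimage_itvoy (fun x => `|f x|) v).
by apply: measurableT_comp => //; exact: measurable_itv.
Qed.

Lemma distr_ge0 f v : (0 <= distr mu f v)%E.
Proof. exact: measure_ge0. Qed.

Lemma le_distr f v w : measurable_fun setT f -> w <= v ->
  (distr mu f v <= distr mu f w)%E.
Proof.
move=> mf wv; apply: le_measure; rewrite ?inE; try exact: measurable_distr_set.
by move=> x /=; exact: le_lt_trans.
Qed.

Lemma le_distr_fun f g v w : measurable_fun setT f -> measurable_fun setT g ->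
  (forall x, v < `|f x| -> w < `|g x|) -> (distr mu f v <= distr mu g w)%E.
Proof.
move=> mf mg fg; apply: le_measure; rewrite ?inE; try exact: measurable_distr_set.
by move=> x /=; exact: fg.
Qed.

Lemma rearr_ge0 f t : (0 <= rearr mu f t)%E.
Proof. by apply/ereal_infP => _ [v /= [v0 _] <-]; rewrite lee_fin ltW. Qed.

Lemma rearr_fun_ge0 f t : 0 <= rearr_fun mu f t.
Proof. exact/fine_ge0/rearr_ge0. Qed.

Lemma rearr_le f t v : 0 < v -> (distr mu f v <= t%:E)%E ->
  (rearr mu f t <= v%:E)%E.
Proof. by move=> v0 fv; apply: ereal_inf_lbound; exists v. Qed.

Lemma le_rearr f t v : measurable_fun setT f -> (t%:E < distr mu f v)%E ->
  (v%:E <= rearr mu f t)%E.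
Proof.
move=> mf tv; apply/ereal_infP => _ [w /= [w0 wt] <-]; rewrite lee_fin leNgt.
apply/negP => wv; move: tv; rewrite ltNge (le_trans _ wt)//.
exact/le_distr/ltW.
Qed.

Lemma rearr_nonincreasing f (s t : R) : s <= t -> (rearr mu f t <= rearr mu f s)%E.
Proof.
move=> st; apply/ereal_infP => _ [w /= [w0 ws] <-].
by apply: rearr_le => //; rewrite (le_trans ws)// lee_fin.
Qed.

(** The sets where [|f|] exceeds [v + n] decrease to the empty set and the first has finite measure,
    so their measures tend to 0 and one of them is at most [t]. *)
Lemma rearr_lt_pinfty f t : Sfun mu f -> 0 < t -> (rearr mu f t < +oo)%E.
Proof.
move=> [mf [v [v0 fv]]] t0.
pose F (n : nat) := [set x | v + n%:R < `|f x|].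
have mF n : measurable (F n) by exact: measurable_distr_set.
have : mu (F n) @[n --> \oo] --> mu (\bigcap_n F n).
  apply: nonincreasing_cvg_mu => //.
  - by rewrite /F addr0.
  - exact: bigcapT_measurable.
  - move=> m n mn; apply/subsetPset => x; rewrite /F/=; apply: le_lt_trans.
    by rewrite lerD2l ler_nat.
rewrite (_ : \bigcap_n F n = set0) ?measure0; last first.
  apply/seteqP; split => // x /(_ (Num.truncn `|f x|).+1 I); rewrite /F/=.
  apply/negP; rewrite -leNgt.
  have /andP[_ /ltW fx] := truncn_itv (normr_ge0 (f x)).
  by rewrite (le_trans fx)// lerDr ltW.
move=> muF; have [[n Fn]|nF] := pselect (exists n, (mu (F n) <= t%:E)%E).
  apply: (le_lt_trans (y := (v + n%:R)%:E)); last exact: ltry.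
  by apply: rearr_le => //; rewrite ltr_wpDr.
suff : (t%:E <= 0)%E by rewrite lee_fin leNgt t0.
apply: cvge_ge muF; apply: nearW => n; rewrite leNgt; apply/negP => /ltW Fn.
by apply: nF; exists n.
Qed.

Lemma rearr_fun_EFin f t : Sfun mu f -> 0 < t ->
  (rearr_fun mu f t)%:E = rearr mu f t.
Proof.
move=> Sf t0; rewrite fineK// ge0_fin_numE ?rearr_ge0//.
exact: rearr_lt_pinfty.
Qed.

Lemma measurable_rearr_fun f : measurable_fun setT (rearr_fun mu f).
Proof.
apply: (measurable_comp (F := setT) (f := fine)) => //.
apply: (measurability _ (ErealGenCInfty.measurableE R)).
move=> _ [_ [r ->] <-]; rewrite setTI; apply: is_interval_measurable.
move=> s t /=; rewrite !in_itv/= !andbT => fs ft u /andP[su ut].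
by rewrite in_itv/= andbT (le_trans ft)// rearr_nonincreasing.
Qed.

End distribution.

Lemma rearr_le_distr d (X : measurableType d) d' (Y : measurableType d')
    (R : realType) (mu : {measure set X -> \bar R})
    (nu : {measure set Y -> \bar R}) (f : X -> R) (g : Y -> R) t :
  (forall v, 0 < v -> (distr mu f v <= distr nu g v)%E) ->
  (rearr mu f t <= rearr nu g t)%E.
Proof.
move=> fg; apply/ereal_infP => _ [v /= [v0 gv] <-].
by apply: rearr_le => //; rewrite (le_trans _ gv)// fg.
Qed.

Section rearr_rearr.
Context d {X : measurableType d} {R : realType}.
Variable mu : {measure set X -> \bar R}.
Implicit Type f : X -> R.

(** One half of the equimeasurability of [f] and its rearrangement: at [t = distr mu f v] the
    rearrangement is at most [v], so by monotonicity it exceeds [v] only inside []0, t[]. *)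
Lemma distr_rearr_fun_le f v : Sfun mu f -> 0 < v ->
  (distr leb_pos (rearr_fun mu f) v <= distr mu f v)%E.
Proof.
move=> Sf v0; have [->|] := eqVneq (distr mu f v) +oo%E; first exact: leey.
rewrite -ltey => fv.
have fE : distr mu f v = (fine (distr mu f v))%:E.
  by rewrite fineK// ge0_fin_numE// distr_ge0.
have t0 : 0 <= fine (distr mu f v) by apply: fine_ge0; exact: distr_ge0.
rewrite fE -(leb_pos_itv t0) [X in (X <= _)%E]leb_posE.
rewrite leb_posE; apply: le_measure; rewrite ?inE.
- apply: measurableI => //.
  by apply: measurable_distr_set; exact: measurable_rearr_fun.
- by apply: measurableI; exact: measurable_itv.
move=> s /=; rewrite !in_itv/= !andbT => -[vs s0]; split => //.
rewrite s0/= ltNge; apply/negP => ts; move: vs; apply/negP; rewrite -leNgt.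
rewrite ger0_norm ?rearr_fun_ge0// -lee_fin rearr_fun_EFin//.
by apply: rearr_le => //; rewrite fE lee_fin.
Qed.

(** The other half, on the level of rearrangements. If [f] exceeded [v + e] on a set of measure
    above some [u > t], its rearrangement would be at least [v + e] on []0, u[], hence above [v] on
    a set of measure greater than [t]. The margin [e] makes the last inequality strict. *)
Lemma rearr_le_rearr_fun f t : Sfun mu f -> 0 < t ->
  (rearr mu f t <= rearr leb_pos (rearr_fun mu f) t)%E.
Proof.
move=> Sf t0; have mf : measurable_fun setT f by case: Sf.
apply/ereal_infP => _ [v /= [v0 fv] <-].
apply/lee_addgt0Pr => e e0; rewrite -EFinD.
have ve : v < v + e by rewrite ltrDl.
apply: rearr_le; first exact: lt_trans ve.
rewrite leNgt; apply/negP => /lte_dense_fin [u tu uf].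
have u0 : 0 < u := lt_trans t0 tu.
move: fv; apply/negP; rewrite -ltNge (@lt_le_trans _ _ u%:E)//.
rewrite -(leb_pos_itv (ltW u0)); apply: le_measure; rewrite ?inE.
- exact: measurable_itv.
- by apply: measurable_distr_set; exact: measurable_rearr_fun.
move=> s /=; rewrite in_itv/= => /andP[s0 su].
rewrite ger0_norm ?rearr_fun_ge0// (lt_le_trans ve)//.
rewrite -lee_fin rearr_fun_EFin//; apply: le_rearr => //.
by rewrite (le_lt_trans _ uf)// lee_fin ltW.
Qed.

End rearr_rearr.

Lemma distr_leb_posE (R : realType) (f : R -> R) v :
  distr leb_pos f v =
  lebesgue_measure ([set x | v < `|f x|] `&` `]0, +oo[).
Proof. by []. Qed.

(** * Doubling a distribution function by two disjoint copies *)

Section two_copies.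
Context {R : realType}.
Notation mu := (@lebesgue_measure R).
Variable f : R -> R.
Hypothesis mf : measurable_fun setT f.

(** Equals [n] on [[2n, 2n+2[]; subtracting [n + e] brings [[2n+e, 2n+e+1[] back to [[n, n+1[]. *)
Let half (x : R) : R := (Num.truncn (x / 2))%:R.

Let mhalf : measurable_fun setT half.
Proof.
apply: nondecreasing_measurable => // x y xy; rewrite /half ler_nat.
by apply: le_truncn; rewrite ler_pM2r// invr_gt0.
Qed.

(* [copy 0] and [copy 1] are copies of [f] on ]0, +oo[, cut at the integers and
   translated into the unit intervals [2n, 2n+1[ and [2n+1, 2n+2[. *)
Let copy (e : nat) (x : R) : R :=
  if (0 < x - half x - e%:R) && (0 <= x - 2 * half x - e%:R < 1) then f (x - half x - e%:R)
  else 0.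

Let mcopy e : measurable_fun setT (copy e).
Proof.
have m1 (c : R) : measurable_fun setT (fun x : R => x - c * half x - e%:R).
  by apply: measurable_funB => //; apply: measurable_funB => //; exact: measurable_funM.
apply: measurable_fun_ifT => //.
  apply: measurable_and.
    apply: measurable_fun_ltr => //; apply: measurable_funB => //.
    exact: measurable_funB.
  apply: measurable_and; first exact: measurable_fun_ler.
  exact: measurable_fun_ltr.
apply: measurableT_comp => //.
by apply: measurable_funB => //; exact: measurable_funB.
Qed.

(** The pieces [P n] cut [{|f| > v}] at the integers, and [A n] is [P n] translated by [n + e]. The
    [A n] are disjoint and fill the level set of the copy, since the value 0 elsewhere does not
    exceed [v >= 0]; translation invariance and countable additivity conclude. *)
Let distr_copy e v : (e < 2)%N -> 0 <= v ->
  distr leb_pos (copy e) v = distr leb_pos f v.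
Proof.
move=> e2 v0.
pose P (n : nat) := [set y | v < `|f y|] `&` `]0, +oo[ `&` `[n%:R, n.+1%:R[.
pose A n := [set x | P n (x - (n%:R + e%:R))].
have e1 : e%:R <= 1 :> R by rewrite lern1 -ltnS.
have e0 : 0 <= e%:R :> R by [].
have mP n : measurable (P n).
  apply: measurableI; last exact: measurable_itv.
  apply: measurableI; last exact: measurable_itv.
  exact: measurable_distr_set.
have muA n : mu (A n) = mu (P n) by rewrite /A lebesgue_measure_preim_shift.
have mA n : measurable (A n).
  rewrite -[A n]setTI.
  have : measurable_fun setT (fun x : R => x - (n%:R + e%:R)) by exact: measurable_funB.
  exact.
have tP : trivIset setT P.
  move=> i j _ _ [x [[_]]]/=; rewrite !in_itv/= => xi [_ xj].
  by rewrite -(truncn_def xi) -(truncn_def xj).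
have halfA n x : A n x -> half x = n%:R.
  move=> [_] /=; rewrite in_itv/= => /andP[nx xn]; congr (_%:R).
  by apply: truncn_def; apply/andP; split; rewrite -natr1 in xn *; lra.
have tA : trivIset setT A.
  move=> i j _ _ [x [/halfA + /halfA]] => -> /eqP.
  by rewrite eqr_nat => /eqP.
transitivity (\sum_(n <oo) mu (P n))%E; last first.
  rewrite -measure_semi_bigcup//; last exact: bigcupT_measurable.
  rewrite distr_leb_posE; congr (mu _).
  apply/seteqP; split => [x [n _ [] //]|x xP].
  exists (Num.truncn x) => //; split=> //=; rewrite in_itv/=.
  by apply: truncn_itv; case: xP => _ /=; rewrite in_itv/= andbT => /ltW.
under eq_eseriesr do rewrite -muA.
rewrite -measure_semi_bigcup//; last exact: bigcupT_measurable.
rewrite distr_leb_posE; congr (mu _); apply/seteqP; split => [x|x [n _ An]].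
  rewrite /= in_itv/= andbT /copy => -[+ x0].
  case: ifPn => [/andP[hp /andP[h0 h1]]|_]; last by rewrite normr0 ltNge v0.
  have [n hE] : exists n, half x = n%:R by exists (Num.truncn (x / 2)).
  exists n => //.
  rewrite /A /P/= !in_itv/= -natr1 -hE opprD addrA andbT; split; last first.
    by apply/andP; split; lra.
  by split.
have hx := halfA _ _ An; case: An => -[/= fv]; rewrite !in_itv/= andbT -natr1.
move=> x0 /andP[nx xn]; rewrite andbT /copy hx opprD addrA in fv *.
have x0' : 0 < x by have := ler0n R n; lra.
rewrite ifT//; apply/and3P; split; lra.
Qed.

(** Writes twice a distribution function as that of a sum of two functions equimeasurable with [f],
    so that in a symmetric space the quasi-triangle inequality controls the doubling. *)
Lemma two_disjoint_copies : exists g h : R -> R,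
  [/\ measurable_fun setT g, measurable_fun setT h,
    forall v, 0 <= v -> distr leb_pos g v = distr leb_pos f v,
    forall v, 0 <= v -> distr leb_pos h v = distr leb_pos f v &
    forall v, 0 <= v ->
      distr leb_pos (g \+ h) v = (2%:E * distr leb_pos f v)%E].
Proof.
exists (copy 0), (copy 1); split => //; try by move=> v; exact: distr_copy.
move=> v v0; rewrite /distr.
have disj x : copy 0 x = 0 \/ copy 1 x = 0.
  rewrite /copy subr0; case: ifPn; last by left.
  by move=> /and3P[_ _ x1]; right; case: ifPn => // /and3P[]; lra.
rewrite (_ : [set x | _] = [set x | v < `|copy 0 x|] `|` [set x | v < `|copy 1 x|]).
  transitivity (distr leb_pos (copy 0) v + distr leb_pos (copy 1) v)%E; last first.
    by rewrite !distr_copy// (_ : 2%:E = 1%:E + 1%:E)%E// ge0_muleDl// !mul1e.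
  have mS e : measurable [set x | v < `|copy e x|].
    by apply: measurable_distr_set; exact: mcopy.
  rewrite /distr measureU//; [exact: mS|exact: mS|].
  apply/seteqP; split => // x [/=].
  by case: (disj x) => -> /=; rewrite normr0 => h1 h2; lra.
apply/seteqP; split => x /=.
  by case: (disj x) => ->; rewrite ?addr0 ?add0r; [right|left].
by case: (disj x) => ->; rewrite ?addr0 ?add0r normr0 => -[] // h; lra.
Qed.

End two_copies.

(** * Symmetric quasi-Banach function spaces *)

Lemma le_distr_ae d (X : measurableType d) (R : realType)
    (mu : {measure set X -> \bar R}) (f g : X -> R) (v w : R) :
  measurable_fun setT f -> measurable_fun setT g ->
  {ae mu, forall x, v < `|f x| -> w < `|g x|} ->
  (distr mu f v <= distr mu g w)%E.
Proof.
move=> mf mg [Z [mZ Z0 subZ]]; rewrite /distr.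
rewrite -(measureU0 (measurable_distr_set w mg) mZ Z0).
apply: le_measure; rewrite ?inE; first exact: measurable_distr_set.
  by apply: measurableU => //; exact: measurable_distr_set.
move=> x /= fx; have [gx|gx] := pselect (w < `|g x|); first by left.
by right; apply: subZ => /= /(_ fx).
Qed.

Lemma distr_dilation (R : realType) (f : R -> R) (s v : R) : 0 < s ->
  measurable_fun setT f ->
  distr leb_pos (dilation s^-1 f) v = (s%:E * distr leb_pos f v)%E.
Proof.
move=> s0 mf; rewrite /distr /dilation.
have /(leb_pos_preim_scale (c := s^-1)) : measurable [set x | v < `|f x|].
  exact: measurable_distr_set.
by rewrite invr_gt0 invrK => /(_ s0).
Qed.

Lemma measurable_dilation (R : realType) (f : R -> R) (a : R) :
  measurable_fun setT f -> measurable_fun setT (dilation a f).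
Proof. by move=> mf; apply: measurableT_comp => //. Qed.

Section quasi_banach.
Context {R : realType} {E : set (R -> R)} {N : (R -> R) -> R}.
Hypothesis EN : symmetric_quasi_banach E N.
Implicit Types f g : R -> R.

Lemma sqb_measurable f : E f -> measurable_fun setT f.
Proof. by move=> /(sqb_sub EN)[]. Qed.

Lemma sqb_le_distr f g : measurable_fun setT f -> E g ->
  (forall v, 0 < v -> (distr leb_pos f v <= distr leb_pos g v)%E) ->
  E f /\ N f <= N g.
Proof.
move=> mf Eg fg; apply: (sqb_symmetric EN) => //; last first.
  by move=> t t0; exact: rearr_le_distr.
split => //; have [_ [v [v0 gv]]] := sqb_sub EN Eg.
by exists v; split => //; rewrite (le_lt_trans (fg v v0)).
Qed.

Lemma sqb_le_abs f g : measurable_fun setT f -> E g ->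
  (forall x, `|f x| <= `|g x|) -> E f /\ N f <= N g.
Proof.
move=> mf Eg fg; apply: sqb_le_distr => // v v0.
apply: le_distr_fun => //; first exact: sqb_measurable.
by move=> x /lt_le_trans; exact.
Qed.

Lemma sqb_norm f : E f -> E (fun x => `|f x|) /\ N (fun x => `|f x|) <= N f.
Proof.
move=> Ef; apply: sqb_le_abs => // [|x]; last by rewrite normr_id.
by apply: measurableT_comp => //; exact: sqb_measurable.
Qed.

Lemma sqb_subP f g : E f -> E g -> E (f \- g) /\ N (f \- g) = N (g \- f).
Proof.
move=> Ef Eg.
have Egf : E (g \- f).
  rewrite (_ : g \- f = g \+ (fun x => (-1) * f x)).
    by apply: (sqb_add EN) => //; exact: (sqb_scale EN).
  by apply/funext => x /=; rewrite mulN1r.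
have -> : f \- g = (fun x => (-1) * (g \- f) x).
  by apply/funext => x /=; rewrite mulN1r opprB.
split; first exact: (sqb_scale EN).
by rewrite (sqb_norm_scale EN)// normrN1 mul1r.
Qed.

Lemma sqb_quasi_triangle : exists2 K : R, 1 <= K &
  forall f g, E f -> E g -> N (f \+ g) <= K * (N f + N g).
Proof.
have [K NK] := sqb_norm_add EN; exists (Num.max 1 K); first by rewrite le_max lexx.
move=> f g Ef Eg; rewrite (le_trans (NK _ _ Ef Eg))// ler_wpM2r//.
  by rewrite addr_ge0// (sqb_norm_ge0 EN).
by rewrite le_max lexx orbT.
Qed.

(** Doubling the distribution function costs a factor [2 K], by two disjoint copies and the
    quasi-triangle inequality; iterating reaches a power of 2 above [a]. *)
Lemma sqb_distr_mul (a : R) : exists2 c : R, 0 <= c &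
  forall f g, E f -> measurable_fun setT g ->
  (forall v, 0 < v -> (distr leb_pos g v <= a%:E * distr leb_pos f v)%E) ->
  E g /\ N g <= c * N f.
Proof.
have [K K1 NK] := sqb_quasi_triangle.
have K0 : 0 <= K by exact: le_trans K1.
suff H m : exists2 c : R, 0 <= c & forall f g, E f -> measurable_fun setT g ->
  (forall v, 0 < v -> (distr leb_pos g v <= (2 ^+ m)%:E * distr leb_pos f v)%E) ->
  E g /\ N g <= c * N f.
  have [m am] : exists m : nat, a <= 2 ^+ m.
    exists (Num.truncn `|a|).+1; rewrite (le_trans (ler_norm a))//.
    have /andP[_ /ltW /le_trans ->]// := truncn_itv (normr_ge0 a).
    by rewrite -natrX ler_nat; apply: ltnW; exact: ltn_expl.
  have [c c0 Hc] := H m; exists c => // f g Ef mg fg; apply: Hc => // v v0.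
  apply: le_trans (fg v v0) _; apply: lee_wpmul2r; first exact: distr_ge0.
  by rewrite lee_fin.
elim: m => [|m [c c0 IH]].
  exists 1 => // f g Ef mg fg; rewrite mul1r; apply: sqb_le_distr => // v v0.
  by rewrite (le_trans (fg v v0))// expr0 mul1e.
exists (c * (K * 2)) => [|f g Ef mg fg]; first by rewrite mulr_ge0// mulr_ge0.
have mf := sqb_measurable Ef.
have [f1 [f2 [mf1 mf2 df1 df2 df12]]] := two_disjoint_copies mf.
have [Ef1 Nf1] : E f1 /\ N f1 <= N f.
  by apply: sqb_le_distr => // v v0; rewrite df1// ltW.
have [Ef2 Nf2] : E f2 /\ N f2 <= N f.
  by apply: sqb_le_distr => // v v0; rewrite df2// ltW.
have [|Eg Ng] := IH (f1 \+ f2) g (sqb_add EN Ef1 Ef2) mg.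
  by move=> v v0; rewrite df12; last (exact: ltW); rewrite muleA -EFinM -exprSr; exact: fg.
split => //; rewrite (le_trans Ng)// -mulrA ler_wpM2l// (le_trans (NK _ _ Ef1 Ef2))//.
by rewrite -mulrA ler_wpM2l// mulr_natl mulr2n lerD.
Qed.

(** Dilation by [s^-1] multiplies the distribution function by [s]. Boundedness makes the [opnorm]
    in the Boyd indices a true operator norm. *)
Lemma sqb_dilation_bounded (s : R) : 0 < s -> exists2 c : R, 0 <= c &
  forall f, E f -> E (dilation s^-1 f) /\ N (dilation s^-1 f) <= c * N f.
Proof.
move=> s0; have [c c0 Hc] := sqb_distr_mul s; exists c => // f Ef.
have mf := sqb_measurable Ef.
by apply: Hc => // [|v v0]; [exact: measurable_dilation|rewrite distr_dilation].
Qed.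

Lemma sqb_sum (r : seq nat) (u : nat -> R -> R) : (forall n, E (u n)) ->
  E (fun x => \sum_(k <- r) u k x).
Proof.
move=> Eu; elim: r => [|k r IH].
  by under eq_fun do rewrite big_nil; exact: (sqb_0 EN).
under eq_fun do rewrite big_cons.
exact: (sqb_add EN).
Qed.

Section geometric_series.
Variables (K rho : R).
Hypothesis K1 : 1 <= K.
Hypothesis NK : forall f g, E f -> E g -> N (f \+ g) <= K * (N f + N g).
Hypothesis rho0 : 0 < rho.
Hypothesis Krho : K * rho < 1.

Let K0 : 0 < K. Proof. exact: lt_le_trans K1. Qed.

Let rho1 : rho < 1.
Proof. by apply: le_lt_trans Krho; rewrite ler_peMl// ltW. Qed.

(** Peeling off the first term costs a factor [K] on the whole remaining tail, so the bounds should
    satisfy [B m = K (c rho^m + B (m+1))]. The stated value is the solution of this recursion, and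
    [K * rho < 1] makes it nonnegative. *)
Lemma sqb_geometric_tail (c : R) (u : nat -> R -> R) : 0 <= c ->
  (forall n, E (u n)) -> (forall n, N (u n) <= c * rho ^+ n) ->
  forall j m, N (fun x => \sum_(m <= k < m + j) u k x) <=
    c * rho ^+ m * (K / (1 - K * rho)).
Proof.
move=> c0 Eu Nu; have d0 : 0 < 1 - K * rho by rewrite subr_gt0.
elim=> [|j IH] m.
  under eq_fun do rewrite addn0 big_geq//.
  rewrite (_ : N _ = 0); last by apply/(sqb_norm_eq0 EN (sqb_0 EN)); exact: aeW.
  by rewrite !mulr_ge0// ?exprn_ge0 ?invr_ge0 ?ltW.
under eq_fun do rewrite big_ltn ?addnS ?ltnS ?leq_addr// -addSn.
rewrite (le_trans (NK (Eu m) (sqb_sum _ Eu)))//.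
rewrite (@le_trans _ _ (K * (c * rho ^+ m + c * rho ^+ m.+1 * (K / (1 - K * rho)))))//.
  by rewrite ler_pM2l// lerD.
rewrite exprS le_eqVlt; apply/orP; left; apply/eqP.
by field; rewrite gt_eqF.
Qed.

(** Convergence of the partial sums [S m] to [g] in [N] becomes pointwise domination without
    extracting a subsequence: for [m > n] the positive part of [u n - |g|] is at most [|S m - g|],
    so its quasi-norm is 0 and it vanishes a.e. *)
Lemma sqb_geometric_series (c : R) (u : nat -> R -> R) : 0 <= c ->
  (forall n, E (u n)) -> (forall n x, 0 <= u n x) ->
  (forall n, N (u n) <= c * rho ^+ n) ->
  exists g, [/\ E g, N g <= K ^+ 2 / (1 - K * rho) * c &
    forall n, {ae leb_pos, forall x, u n x <= `|g x|}].
Proof.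
move=> c0 Eu u0 Nu; have d0 : 0 < 1 - K * rho by rewrite subr_gt0.
pose S n x := \sum_(0 <= k < n) u k x.
have ES n : E (S n) by exact: sqb_sum.
have tail := sqb_geometric_tail c0 Eu Nu.
pose B := c * (K / (1 - K * rho)).
have B0 : 0 <= B by rewrite mulr_ge0// divr_ge0// ltW.
have NS n : N (S n) <= B.
  by have := tail n 0%N; rewrite expr0 mulr1 add0n.
have NSS m n : (m <= n)%N -> N (S n \- S m) <= B * rho ^+ m.
  move=> mn; have := tail (n - m)%N m; rewrite subnKC// mulrAC -/B.
  congr (N _ <= _); apply/funext => x; rewrite /S /=.
  by rewrite [X in _ = X - _](@big_cat_nat _ _ _ m)//= [RHS]addrC addKr.
have Bcvg (e : R) : 0 < e -> exists n0 : nat, B * rho ^+ n0 < e.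
  move=> e0; have : B * rho ^+ n @[n --> \oo] --> B * 0.
    by apply: cvgMl_tmp; apply: cvg_expr; rewrite ger0_norm// ltW.
  rewrite mulr0 => /cvgrPdist_lt/(_ _ e0)[n0 _ /(_ n0 (leqnn _))].
  rewrite sub0r normrN ger0_norm; last by rewrite mulr_ge0// exprn_ge0// ltW.
  move=> He.
  by exists n0.
have [g Eg Sg] : exists2 f, E f & N (S n \- f) @[n --> \oo] --> (0 : R).
  apply: (sqb_complete EN) => // e e0.
  have [n0 He] := Bcvg e e0; exists n0 => m n.
  wlog mn : m n / (m <= n)%N.
    move=> H m0 n1; have [mn|/ltnW nm] := leqP m n; first exact: H.
    by rewrite (sqb_subP (ES _) (ES _)).2; exact: H.
  move=> m0 n1; rewrite (sqb_subP (ES _) (ES _)).2 (le_lt_trans (NSS _ _ mn))//.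
  rewrite (le_lt_trans _ He)// ler_wpM2l// ler_wiXn2l// ltW//.
have NSg (e : R) : 0 < e -> exists n0, forall n, (n0 <= n)%N -> N (S n \- g) < e.
  move=> e0; have /cvgrPdist_lt/(_ _ e0)[n0 _ Hn0] := Sg.
  exists n0 => n /Hn0; rewrite sub0r normrN ger0_norm//.
  by apply: (sqb_norm_ge0 EN); exact: (sqb_subP _ _).1.
exists g; split => //.
  (* As [N] need not be continuous, [N g] is bounded through [g = S n0 + (g - S n0)]; this is the
     second factor [K] in [K ^+ 2]. *)
  apply/ler_addgt0Pr => e e0.
  have [n0 /(_ _ (leqnn _)) Hn0] := NSg _ (divr_gt0 e0 K0).
  rewrite (_ : g = S n0 \+ (g \- S n0)); last by apply/funext => x /=; rewrite addrC subrK.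
  have [EgS NgS] := sqb_subP Eg (ES n0).
  rewrite (le_trans (NK (ES n0) EgS))// NgS.
  rewrite (@le_trans _ _ (K * (B + e / K)))//.
    by rewrite ler_pM2l// lerD// ltW.
  rewrite le_eqVlt; apply/orP; left; apply/eqP; rewrite /B.
  by field; rewrite !gt_eqF.
move=> n; pose h x := Num.max (u n x - `|g x|) 0.
have mh : measurable_fun setT h.
  apply: measurable_maxr => //; apply: measurable_funB.
    exact: sqb_measurable.
  by apply: measurableT_comp => //; exact: sqb_measurable.
have hS m x : (n < m)%N -> `|h x| <= `|(S m \- g) x|.
  move=> nm; rewrite ger0_norm /h ?le_max ?lexx ?orbT// ge_max normr_ge0 andbT.
  apply: le_trans (ler_norm _); rewrite /=; apply: lerB; last exact: ler_norm.
  rewrite /S (bigD1_seq n) ?iota_uniq ?mem_index_iota//= lerDl.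
  by apply: sumr_ge0.
have Eh m : (n < m)%N -> E h /\ N h <= N (S m \- g).
  move=> nm; apply: sqb_le_abs => //; first exact: (sqb_subP _ _).1.
  by move=> x; exact: hS.
have Eh0 : E h by have [] := Eh n.+1 (ltnSn _).
have : N h = 0.
  apply/eqP; rewrite eq_le (sqb_norm_ge0 EN)// andbT.
  apply/ler_addgt0Pr => e e0; rewrite add0r.
  have [n0 Hn0] := NSg _ e0; apply: (@le_trans _ _ (N (S (maxn n0 n.+1) \- g))).
    by apply: (Eh _ _).2; rewrite leq_maxr.
  by apply/ltW/Hn0; rewrite leq_maxl.
move=> /(sqb_norm_eq0 EN Eh0).
apply: (@filterS _ _ (ae_filter_ringOfSetsType leb_pos)) => x; rewrite /h => hx.
by rewrite -subr_le0 -hx le_max lexx.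
Qed.

End geometric_series.

End quasi_banach.

(** One admissible constant [c] makes the infimum defining [opnorm] run over a nonempty set, and the
    infimum is then admissible itself; vectors of quasi-norm 0, where one cannot divide, are settled
    by [c]. *)
Lemma opnormP (R : realType) (V W : Type) (A : set V) (NA : V -> R) (B : set W)
    (NB : W -> R) (L : V -> W) (c : R) :
  0 <= c -> (forall f, A f -> 0 <= NA f) ->
  (forall f, A f -> B (L f) /\ NB (L f) <= c * NA f) ->
  forall f, A f -> B (L f) /\ NB (L f) <= opnorm A NA B NB L * NA f.
Proof.
move=> c0 NA0 Lc f Af; split; first exact: (Lc f Af).1.
have := NA0 f Af; rewrite le_eqVlt => /predU1P[f0|f0].
  by rewrite -f0 mulr0; have := (Lc f Af).2; rewrite -f0 mulr0.
rewrite -ler_pdivrMr//; apply: lb_le_inf; first by exists c.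
by move=> k [k0 Lk]; rewrite ler_pdivrMr//; exact: (Lk f Af).2.
Qed.

Lemma opnorm_ge0 (R : realType) (V W : Type) (A : set V) (NA : V -> R)
    (B : set W) (NB : W -> R) (L : V -> W) : 0 <= opnorm A NA B NB L.
Proof.
rewrite /opnorm; set S := (X in inf X); have [->|/set0P S0] := eqVneq S set0.
  by rewrite inf0.
by apply: lb_le_inf => // c [].
Qed.

Lemma exists_exprn_gt (R : realType) (b x : R) : 1 < b -> exists n : nat, x < b ^+ n.
Proof.
move=> b1; have b0 : 0 < b by exact: lt_trans b1.
have [x0|x0] := leP x 0; first by exists 0%N; rewrite expr0 (le_lt_trans x0).
have : b^-1 ^+ n @[n --> \oo] --> (0 : R).
  by apply: cvg_expr; rewrite ger0_norm ?invf_lt1// invr_ge0 ltW.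
have ix0 : 0 < x^-1 by rewrite invr_gt0.
move=> /cvgrPdist_lt/(_ _ ix0)[n _ /(_ n (leqnn _))].
rewrite sub0r normrN ger0_norm; last by rewrite exprn_ge0// invr_ge0 ltW.
by rewrite exprVn ltf_pV2 ?posrE ?exprn_gt0//; exists n.
Qed.

Lemma exprn_bracket_oc (R : realType) (b x : R) : 1 < b -> 1 < x ->
  exists n : nat, b ^+ n < x <= b ^+ n.+1.
Proof.
move=> b1 x1; have [n0 xn0] := exists_exprn_gt x b1.
have ex : exists n : nat, x <= b ^+ n by exists n0; rewrite ltW.
case: (ex_minnP ex) => -[|n]; first by rewrite expr0 leNgt x1.
move=> xn nmin; exists n; rewrite xn andbT ltNge.
by apply/negP => /nmin; rewrite ltnn.
Qed.

Lemma exprn_bracket_co (R : realType) (b x : R) : 1 < b -> 1 <= x ->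
  exists n : nat, b ^+ n <= x < b ^+ n.+1.
Proof.
move=> b1 x1; have ex := exists_exprn_gt x b1.
case: (ex_minnP ex) => -[|n]; first by rewrite expr0 ltNge x1.
move=> xn nmin; exists n; rewrite xn andbT leNgt.
by apply/negP => /nmin; rewrite ltnn.
Qed.

Lemma exists_powR_ge (R : realType) (e M : R) : 0 < e ->
  exists b0 : R, forall b, b0 <= b -> M <= b `^ e.
Proof.
move=> e0; exists (Num.max M 0 `^ e^-1) => b bM.
have M0 : 0 <= Num.max M 0 by rewrite le_max lexx orbT.
have := powR_ge0 (Num.max M 0) e^-1 => b0.
apply: (@le_trans _ _ (Num.max M 0)); first by rewrite le_max lexx.
rewrite -[leLHS]powRr1// -(mulVf (lt0r_neq0 e0)) powRrM.
by apply: ge0_ler_powR; rewrite ?nnegrE//; [exact: ltW|exact: le_trans b0 bM].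
Qed.

Lemma sum_geometric_le (R : realType) (r : R) n : 0 <= r < 1 ->
  \sum_(0 <= k < n) r ^+ k <= (1 - r)^-1.
Proof.
move=> /andP[r0 r1]; have d0 : 0 < 1 - r by rewrite subr_gt0.
rewrite -[leRHS]mul1r ler_pdivlMr// mulr_suml.
suff -> : \sum_(0 <= k < n) r ^+ k * (1 - r) = 1 - r ^+ n.
  by rewrite gerBl exprn_ge0.
elim: n => [|n IH]; first by rewrite big_geq// expr0 subrr.
by rewrite big_nat_recr//= IH exprS; ring.
Qed.

(** * Domination of an integral by a single distribution function *)

Section layers.
Context {R : realType}.
Variables (f : R -> R) (y c : nat -> R).
Hypothesis mf : measurable_fun setT f.
Hypothesis c0 : forall n, 0 <= c n.

Let S n := [set x | y n < `|f x|].

Let mS n : measurable (S n). Proof. exact: measurable_distr_set. Qed.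

Let cS0 n x : (0 <= (c n)%:E * (\1_(S n) x)%:E)%E.
Proof. by rewrite -EFinM lee_fin mulr_ge0. Qed.

Let mI n : measurable_fun setT (fun x => (\1_(S n) x)%:E : \bar R).
Proof. by apply/measurable_EFinP; exact: measurable_indic. Qed.

Let mcS n : measurable_fun setT (fun x => ((c n)%:E * (\1_(S n) x)%:E)%E).
Proof. by apply: emeasurable_funM => //; exact: mI. Qed.

(** The common form of two majorants: of [psi (|f| / w)] in the bound for [Theta], and of [Phi |g|]
    in the modular estimate. *)
Definition layers x : \bar R :=
  (\sum_(n <oo) ((c n)%:E * (\1_([set t | y n < `|f t|]) x)%:E))%E.

Lemma layers_ge0 x : (0 <= layers x)%E.
Proof. exact: nneseries_ge0. Qed.

Lemma layers_ge n x : y n < `|f x| -> ((c n)%:E <= layers x)%E.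
Proof.
move=> ny; rewrite /layers (@nneseriesD1 _ _ n)//.
rewrite indicE mem_set// mule1 -[leLHS]adde0; apply: leeD => //.
exact: nneseries_ge0.
Qed.

Lemma measurable_layers : measurable_fun setT layers.
Proof.
by apply: ge0_emeasurable_sum => [n x _ _|n _]; [exact: cS0|exact: mcS].
Qed.

Lemma integral_layers : (\int[leb_pos]_x layers x =
  \sum_(n <oo) (c n)%:E * distr leb_pos f (y n))%E.
Proof.
rewrite integral_nneseries//; apply: eq_eseriesr => n _.
rewrite ge0_integralZl//.
- congr (_ * _)%E; rewrite integral_indic ?setIT//; exact: mS.
- exact: mI.
- by rewrite lee_fin.
Qed.

End layers.

Section domination.
Context {R : realType} {E : set (R -> R)} {N : (R -> R) -> R}.
Hypothesis EN : symmetric_quasi_banach E N.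
Variables (K rho : R).
Hypothesis K1 : 1 <= K.
Hypothesis NK : forall f g, E f -> E g -> N (f \+ g) <= K * (N f + N g).
Hypothesis rho0 : 0 < rho.
Hypothesis Krho : K * rho < 1.

(* If [psi] is dominated by jumps of height [c n] at [y n], the integral of
   [psi (|f| / w)] is a sum of values of the distribution function of [f]; the
   geometric series of the dilations of [f] by [s n], scaled by [1 / y n],
   dominates them all at the same level [w]. *)
Lemma sqb_integral_le_distr (psi : R -> R) (y s c : nat -> R) (A B : R) :
  measurable_fun setT psi -> (forall a, 0 <= psi a) ->
  (forall n, 0 < y n) -> (forall n, 0 < s n) -> (forall n, 0 <= c n) ->
  (forall a, 0 <= a -> psi a = 0 \/ exists2 n, y n < a & psi a <= c n) ->
  (forall n, \sum_(0 <= k < n) c k / s k <= A) -> 0 <= B ->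
  (forall n f, E f -> E (dilation (s n)^-1 f) /\
     N (dilation (s n)^-1 f) <= B * rho ^+ n * y n * N f) ->
  exists2 C : R, 0 <= C & forall f, E f -> exists g, [/\ E g, N g <= C * N f &
    forall w, 0 < w ->
    (\int[leb_pos]_x (psi (`|f x| / w))%:E <= A%:E * distr leb_pos g w)%E].
Proof.
move=> mpsi psi0 y0 s0 c0 psiy cs B0 dil.
exists (K ^+ 2 / (1 - K * rho) * B) => [|f Ef].
  by rewrite mulr_ge0// divr_ge0 ?exprn_ge0 ?subr_ge0 ?ltW// (lt_le_trans _ K1).
have mf := sqb_measurable EN Ef.
have mdil n : measurable_fun setT (dilation (s n)^-1 f).
  exact: measurable_dilation.
pose u n x := (y n)^-1 * `|dilation (s n)^-1 f x|.
have Nf0 := sqb_norm_ge0 EN Ef.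
have Eabs n : E (fun x => `|dilation (s n)^-1 f x|).
  exact: (sqb_norm EN (dil n f Ef).1).1.
have Eu n : E (u n) by exact: (sqb_scale EN).
have Nu n : N (u n) <= B * N f * rho ^+ n.
  rewrite /u (sqb_norm_scale EN)// ger0_norm ?invr_ge0 ?(ltW (y0 n))//.
  rewrite ler_pdivrMl// (le_trans (sqb_norm EN (dil n f Ef).1).2)//.
  rewrite (le_trans (dil n f Ef).2)// le_eqVlt; apply/orP; left; apply/eqP; ring.
have u0 n x : 0 <= u n x by rewrite mulr_ge0// invr_ge0 ltW.
have [g [Eg Ng ug]] :=
  sqb_geometric_series EN K1 NK rho0 Krho (mulr_ge0 B0 Nf0) Eu u0 Nu.
exists g; split => // [|w w0]; first by rewrite -mulrA.
have mg := sqb_measurable EN Eg.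
(* [g] dominates [u n] a.e., and [u n > w] means that the dilate of [f] exceeds [w * y n], which
   happens on a set [s n] times as large as for [f]. *)
have sg n : ((s n)%:E * distr leb_pos f (w * y n) <= distr leb_pos g w)%E.
  rewrite -distr_dilation//; apply: le_distr_ae; [exact: mdil|exact: mg|].
  move: (ug n); apply: (@filterS _ _ (ae_filter_ringOfSetsType leb_pos)) => x ux wx.
  by apply: lt_le_trans ux; rewrite /u ltr_pdivlMl// mulrC.
apply: (@le_trans _ _ (\int[leb_pos]_x layers f (fun n => w * y n)%R c x)%E).
  apply: ge0_le_integral => //.
  - by move=> x _; rewrite lee_fin.
  - apply/measurable_EFinP; apply: measurableT_comp => //.
    by apply: measurable_funM => //; apply: measurableT_comp.
  - exact: measurable_layers.
  move=> x _; have fw0 : 0 <= `|f x| / w by rewrite divr_ge0// ltW.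
  have [->|[n ny psic]] := psiy _ fw0; first exact: layers_ge0.
  apply: (@le_trans _ _ (c n)%:E); first by rewrite lee_fin.
  by apply: layers_ge => //; rewrite mulrC -ltr_pdivlMr.
rewrite integral_layers//.
apply: lime_le.
  by apply: is_cvg_nneseries => n _ _; rewrite mule_ge0// ?lee_fin// distr_ge0.
apply: nearW => n.
apply: (@le_trans _ _ ((\sum_(0 <= k < n) (c k / s k)%:E) * distr leb_pos g w)%E).
  rewrite ge0_sume_distrl => [|k _]; last by rewrite lee_fin divr_ge0// ltW.
  apply: lee_sum => k _; rewrite EFinM -muleA; apply: lee_wpmul2l; first by rewrite lee_fin.
  by rewrite muleC lee_pdivlMr// muleC.
by rewrite sumEFin; apply: lee_wpmul2r; rewrite ?distr_ge0// lee_fin.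
Qed.

End domination.

(** * The distribution function of Theta f *)

Section marcinkiewicz_weight.
Context {R : realType}.
Implicit Types (p a : R) (q : \bar R).

Definition marc_hi p a : R := if 1 < a then a `^ p else 0.

(** The value 0 for [q = +oo] is the right one: [theta] is then 1 on []0, 1[] and at most 1 beyond,
    so for [a <= 1] the product [a * theta] never exceeds 1. *)
Definition marc_lo q a : R :=
  if 1 < a then 0 else if q is q0%:E then a `^ q0 else 0.

Definition marc p q a : R := marc_hi p a + marc_lo q a.

Lemma marc_hi_ge0 p a : 0 <= marc_hi p a.
Proof. by rewrite /marc_hi; case: ifP => // _; exact: powR_ge0. Qed.

Lemma marc_lo_ge0 q a : 0 <= marc_lo q a.
Proof. by rewrite /marc_lo; case: ifP => // _; case: q => // r; exact: powR_ge0. Qed.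

Lemma marc_ge0 p q a : 0 <= marc p q a.
Proof. by rewrite addr_ge0 ?marc_hi_ge0 ?marc_lo_ge0. Qed.

Lemma measurable_marc_hi p : measurable_fun setT (marc_hi p).
Proof. by apply: measurable_fun_ifT => //; exact: measurable_fun_ltr. Qed.

Lemma measurable_marc_lo q : measurable_fun setT (marc_lo q).
Proof.
by apply: measurable_fun_ifT => //; [exact: measurable_fun_ltr|case: q].
Qed.

Lemma measurable_marc p q : measurable_fun setT (marc p q).
Proof.
by apply: measurable_funD; [exact: measurable_marc_hi|exact: measurable_marc_lo].
Qed.

Lemma marc_gt1 p q a : 1 < a -> marc p q a = a `^ p.
Proof. by move=> a1; rewrite /marc /marc_hi /marc_lo a1 addr0. Qed.

Lemma marc_le1 p q a : a <= 1 ->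
  marc p q a = if q is q0%:E then a `^ q0 else 0.
Proof. by move=> a1; rewrite /marc /marc_hi /marc_lo ltNge a1 add0r. Qed.

Lemma powRV_lt (r t b : R) : 0 < r -> 0 <= t -> 0 <= b ->
  (t `^ r^-1 < b) = (t < b `^ r).
Proof.
move=> r0 t0 b0; have tE : (t `^ r^-1) `^ r = t.
  by rewrite -powRrM mulVf ?gt_eqF// powRr1.
apply/idP/idP => [tb|]; first by rewrite -tE gt0_ltr_powR ?nnegrE// powR_ge0.
by apply: contraLR; rewrite -!leNgt => bt; rewrite -[leRHS]tE ge0_ler_powR ?nnegrE ?powR_ge0// ltW.
Qed.

Lemma lt_mul_powRNV (r t a w : R) : 0 < r -> 0 < t -> 0 <= a -> 0 < w ->
  (w < a * t `^ (- r^-1)) = (t < (a / w) `^ r).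
Proof.
move=> r0 t0 a0 w0; rewrite -powRV_lt ?(ltW t0)//; last by rewrite divr_ge0// ltW.
by rewrite powRN ltr_pdivlMr ?powR_gt0// ltr_pdivlMr// mulrC.
Qed.

(** If [a > w], all of []0, 1[] is in the slice, which extends to [(a / w)^p] along the branch of
    exponent [-1/p]. If [a <= w], nothing beyond 1 survives, and the other branch leaves []0, (a /
    w)^q[], or nothing when [q = +oo]. *)
Lemma theta_slice p q a w t : 0 < p -> (p%:E < q)%E -> 0 <= a -> 0 < w -> 0 < t ->
  (w < a * theta p%:E q t) = (t < marc p q (a / w)).
Proof.
move=> p0 pq a0 w0 t0; rewrite /theta !indicE.
have aw0 : 0 <= a / w by rewrite divr_ge0// ltW.
have one (r : R) : 1 `^ r = 1 by rewrite powR1.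
have [t1|t1] := ltP t 1.
  rewrite mem_set ?mulr1; last by rewrite /= in_itv/= t0 t1.
  rewrite memNset ?mulr0 ?addr0; last by rewrite /= in_itv/= andbT leNgt t1.
  have [aw1|aw1] := ltP 1 (a / w).
    have aw : w < a by rewrite ltr_pdivlMr ?mul1r in aw1.
    rewrite marc_gt1//; transitivity true; last first.
      apply/esym/(lt_trans t1).
      by rewrite -[ltLHS](one p) gt0_ltr_powR ?nnegrE.
    apply/idP; apply: (lt_le_trans aw); rewrite ler_peMr//.
    case: q pq => [r| |]//= pq; last by rewrite oppr0 powRr0.
    have r0 : 0 < r by rewrite lte_fin in pq; exact: lt_trans pq.
    rewrite ?inver gt_eqF//= -[leLHS](powRr0 t); apply: ger_powR.
      by rewrite t0 ltW.
    by rewrite oppr_le0 invr_ge0 ltW.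
  rewrite marc_le1//; case: q pq => [r| |]//= pq.
    have r0 : 0 < r by rewrite lte_fin in pq; exact: lt_trans pq.
    by rewrite ?inver gt_eqF//= lt_mul_powRNV.
  rewrite oppr0 powRr0 mulr1; apply/idP/idP; last by rewrite ltNge ltW.
  by rewrite ltNge -[w]mul1r -ler_pdivrMr// aw1.
rewrite memNset ?mulr0 ?add0r; last by rewrite /= in_itv/= t0/= ltNge t1.
rewrite mem_set ?mulr1; last by rewrite /= in_itv/= andbT.
rewrite ?inver gt_eqF//= lt_mul_powRNV//.
have [aw1|aw1] := ltP 1 (a / w); first by rewrite marc_gt1.
rewrite marc_le1//.
have pw (r : R) : 0 < r -> (a / w) `^ r <= t.
  move=> r0; apply: le_trans t1; rewrite -[leRHS](one r).
  by rewrite ge0_ler_powR ?nnegrE// ltW.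
case: q pq => [r| |]//= pq; last by rewrite !ltNge pw// ltW.
have r0 : 0 < r by rewrite lte_fin in pq; exact: lt_trans pq.
by rewrite !ltNge !pw.
Qed.

Lemma theta_ge0 (p q : \bar R) t : 0 <= theta p q t.
Proof. by rewrite /theta addr_ge0// mulr_ge0// powR_ge0. Qed.

Lemma measurable_theta (p q : \bar R) : measurable_fun setT (@theta R p q).
Proof.
by apply: measurable_funD; apply: measurable_funM => //; exact: measurable_indic.
Qed.

Lemma measurable_Theta (p q : \bar R) (f : R -> R) : measurable_fun setT f ->
  measurable_fun setT (Theta p q f : measurableTypeR R * measurableTypeR R -> R).
Proof.
move=> mf; apply: measurable_funM; first exact: measurableT_comp.
by apply: measurableT_comp => //; exact: measurable_theta.
Qed.

Lemma distr_Theta p q (f : R -> R) w : 0 < p -> (p%:E < q)%E -> 0 < w ->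
  measurable_fun setT f ->
  distr leb_quadrant (Theta p%:E q f) w =
  (\int[leb_pos]_x (marc p q (`|f x| / w))%:E)%E.
Proof.
move=> p0 pq w0 mf; rewrite /distr /leb_quadrant /product_measure1/=.
apply: eq_integral => x _ /=.
rewrite -(leb_pos_itv (marc_ge0 p q (`|f x| / w))) !leb_posE; congr lebesgue_measure.
apply/seteqP; split => t /=; rewrite !in_itv/= !andbT.
  move=> [+ t0]; rewrite t0 /xsection/= inE/= /Theta/= normrM (ger0_norm (theta_ge0 _ _ _)).
  by rewrite theta_slice.
move=> [/andP[t0 tm] _]; split => //; rewrite /xsection/= inE/= /Theta/= normrM.
by rewrite (ger0_norm (theta_ge0 _ _ _)) theta_slice.
Qed.

End marcinkiewicz_weight.

(** * Boyd indices *)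

(* Without convergence, [lim] is the default point [0]. *)
Lemma lim_gt0_cvg (R : realFieldType) (T : Type) (F : set_system T) {FF : ProperFilter F}
    (f : T -> \bar R) :
  (0 < lim (f x @[x --> F]))%E -> f x @[x --> F] --> lim (f x @[x --> F]).
Proof.
have [//|ncv] := pselect (cvg (f x @[x --> F])).
by rewrite (dvgP ncv) ltxx.
Qed.

Lemma ln_le_powR (R : realType) (c s e : R) : 0 < s -> 0 <= c ->
  ln c <= e * ln s -> c <= s `^ e.
Proof.
move=> s0; rewrite le_eqVlt => /predU1P[<- _|c0 cs]; first exact: powR_ge0.
by rewrite /powR gt_eqF// -[leLHS]lnK ?posrE// ler_expR.
Qed.

Lemma powR_exprn (R : realType) (x e : R) n : 0 <= x ->
  (x ^+ n) `^ e = (x `^ e) ^+ n.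
Proof.
by move=> x0; rewrite -(powR_mulrn n x0) -(powR_mulrn n (powR_ge0 x e)) powRAC.
Qed.

Section boyd.
Context {R : realType} {E : set (R -> R)} {N : (R -> R) -> R}.
Hypothesis EN : symmetric_quasi_banach E N.

Lemma sqb_dilation_opnorm (s : R) f : 0 < s -> E f ->
  E (dilation s^-1 f) /\
  N (dilation s^-1 f) <= opnorm E N E N (dilation s^-1) * N f.
Proof.
move=> s0; have [c c0 Hc] := sqb_dilation_bounded EN s0.
by move: f; apply: opnormP c0 _ Hc => f; exact: (sqb_norm_ge0 EN).
Qed.

Lemma sqb_dilation_powR (s e : R) f : 0 < s -> E f ->
  ln (opnorm E N E N (dilation s^-1)) <= e * ln s ->
  E (dilation s^-1 f) /\ N (dilation s^-1 f) <= s `^ e * N f.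
Proof.
move=> s0 Ef le; have [Edf Ndf] := sqb_dilation_opnorm s0 Ef; split => //.
rewrite (le_trans Ndf)// ler_wpM2r ?(sqb_norm_ge0 EN)//.
by apply: ln_le_powR => //; exact: opnorm_ge0.
Qed.

(** For [s > 1] a finite quotient above [p' > 0] forces the logarithm of the dilation norm to be
    positive, and clearing denominators bounds the norm by a power of [s]. The [+oo] branch, where
    that logarithm is 0, satisfies the same bound because [ln s > 0]. *)
Lemma boyd_lower_dilation (p : R) : 0 < p -> (p%:E < boyd_lower E N)%E ->
  exists2 p' : R, p < p' & exists s0 : R, forall s f, s0 <= s -> E f ->
  E (dilation s^-1 f) /\ N (dilation s^-1 f) <= s `^ p'^-1 * N f.
Proof.
move=> p0 /lte_dense_fin[p' pp' p'E]; exists p' => //.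
have p'0 : 0 < p' := lt_trans p0 pp'.
have : (0 < boyd_lower E N)%E by apply: lt_trans p'E.
move=> /lim_gt0_cvg /(_ _ (open_ereal_gt' p'E)) [M [_ HM]].
exists (Num.max 2 (M + 1)) => s f; rewrite ge_max => /andP[s2 sM].
have s0 : 0 < s by exact: lt_le_trans s2.
have lns : 0 < ln s by rewrite ln_gt0// (lt_le_trans _ s2)// ltr1n.
have {HM} : (p'%:E < boyd_quotient E N s)%E.
  by apply: HM; rewrite (lt_le_trans _ sM)// ltrDl.
move=> Hq Ef; apply: sqb_dilation_powR => //; move: Hq; rewrite /boyd_quotient /=.
set l := ln _; case: eqP => [-> _|/eqP l0].
  by rewrite mulr_ge0 ?invr_ge0 ?ltW.
rewrite lte_fin => pl.
have lpos : 0 < l.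
  rewrite lt_neqAle eq_sym l0/= leNgt; apply/negP => l1.
  have := lt_trans p'0 pl; rewrite ltNge => /negP; apply.
  by rewrite mulr_ge0_le0 ?ltW// invr_lt0.
by rewrite ltr_pdivlMr// in pl; rewrite ler_pdivlMl// ltW.
Qed.

(** Here [ln s < 0]. The positive limit keeps the quotient positive near 0, so the logarithm of the
    norm is negative too and the direction of the inequality is known when denominators are cleared;
    the [+oo] branch contradicts the upper bound on the quotient. *)
Lemma boyd_upper_dilation (q : R) : (0 < boyd_upper E N)%E ->
  (boyd_upper E N < q%:E)%E ->
  exists2 q' : R, 0 < q' < q & exists2 s0 : R, 0 < s0 &
  forall s f, 0 < s <= s0 -> E f ->
  E (dilation s^-1 f) /\ N (dilation s^-1 f) <= s `^ q'^-1 * N f.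
Proof.
move=> u0 uq.
have [q' uq' q'q] : exists2 q' : R, (boyd_upper E N < q'%:E)%E & q' < q.
  move: u0 uq; case: (boyd_upper E N) => [r| |]//; rewrite !lte_fin => r0 rq.
  by exists ((r + q) / 2); rewrite ?lte_fin midf_lt.
have q'0 : 0 < q' by rewrite -lte_fin; exact: lt_trans uq'.
exists q'; first by rewrite q'0.
have uc : boyd_quotient E N x @[x --> 0^'+] --> boyd_upper E N.
  exact: lim_gt0_cvg.
have := filterI (uc _ (open_ereal_gt' u0)) (uc _ (open_ereal_lt' uq')).
move=> [e /= e0 He]; exists (Num.min (e / 2) 2^-1).
  by rewrite lt_min divr_gt0//= invr_gt0.
move=> s f /andP[s0]; rewrite le_min => /andP[se s2].
have lns : ln s < 0 by rewrite ln_lt0// s0/= (le_lt_trans s2)// invf_lt1// ltr1n.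
have Hs : ball_ Num.norm 0 e s.
  by rewrite /ball_ /= sub0r normrN gtr0_norm//; lra.
have [/= ql qu] := He s Hs s0.
move=> Ef; apply: sqb_dilation_powR => //; move: ql qu; rewrite /boyd_quotient /=.
set l := ln _; case: eqP => [//|/eqP l0].
rewrite !lte_fin => ql qu.
have lneg : l < 0.
  rewrite lt_neqAle l0/= leNgt; apply/negP => l1.
  move: ql; rewrite ltNge => /negP; apply.
  by rewrite mulr_le0_ge0 ?ltW// invr_gt0.
by rewrite ltr_ndivrMr// in qu; rewrite ler_pdivlMl// ltW.
Qed.

Section dominated.
Variable K : R.
Hypothesis K1 : 1 <= K.
Hypothesis NK : forall f g, E f -> E g -> N (f \+ g) <= K * (N f + N g).

Let K0 : 0 < K. Proof. exact: lt_le_trans K1. Qed.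

(** Jumps at [b^n] of height [b^(p(n+1))], dilations by [s_n = b^(mn)] with [p < m < p']. Then
    [c_n / s_n = b^p b^((p-m)n)] is summable since [p < m], and the dilation norm divided by [b^n]
    is at most [b^(-en)] with [e = 1 - m / p' > 0] since [m < p']. Taking [b^e >= 2 K] gives
    [K * rho < 1]. *)
Lemma sqb_marc_hi_le_distr (p p' s0 : R) : 0 < p -> p < p' ->
  (forall s f, s0 <= s -> E f ->
    E (dilation s^-1 f) /\ N (dilation s^-1 f) <= s `^ p'^-1 * N f) ->
  exists A : R, exists2 C : R, 0 <= C & forall f, E f -> exists g,
  [/\ E g, N g <= C * N f & forall w, 0 < w ->
    (\int[leb_pos]_x (marc_hi p (`|f x| / w))%:E <= A%:E * distr leb_pos g w)%E].
Proof.
move=> p0 pp' dil; pose m := (p + p') / 2; pose e := 1 - m / p'.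
have p'0 : 0 < p' := lt_trans p0 pp'.
have pm : p < m by rewrite /m; lra.
have mp' : m < p' by rewrite /m; lra.
have m0 : 0 < m := lt_trans p0 pm.
have e0 : 0 < e by rewrite subr_gt0 ltr_pdivrMr// mul1r.
have [b1 Hb1] := exists_powR_ge (2 * K) e0.
have [b2 Hb2] := exists_powR_ge s0 m0.
pose b := Num.max 2 (Num.max b1 b2).
have b2' : 2 <= b by rewrite /b le_max lexx.
have b0 : 0 < b by exact: lt_le_trans b2'.
have bn0 : b != 0 by rewrite gt_eqF.
have bb1 : 1 < b by rewrite (lt_le_trans _ b2')// ltr1n.
have {Hb1} bK : 2 * K <= b `^ e by apply: Hb1; rewrite /b !le_max lexx !orbT.
have {Hb2} bs : s0 <= b `^ m by apply: Hb2; rewrite /b !le_max lexx !orbT.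
have bgt (x : R) : 0 < b `^ x by exact: powR_gt0.
have b1m (x : R) : 0 <= x -> 1 <= b `^ x.
  by move=> x0; rewrite -(powRr0 b) ler_powR// ltW.
pose rho := b `^ (- e).
have Kr : K * rho < 1.
  rewrite /rho powRN ltr_pdivrMr// mul1r (lt_le_trans _ bK)//.
  by rewrite mulr_natl mulr2n ltrDl.
exists (b `^ p * (1 - b `^ (p - m))^-1).
apply: (@sqb_integral_le_distr _ _ _ EN _ rho K1 NK (bgt _) Kr _
  (fun n => b ^+ n) (fun n => (b `^ m) ^+ n) (fun n => (b `^ p) ^+ n.+1) _ 1) => //.
- exact: measurable_marc_hi.
- exact: marc_hi_ge0.
- by move=> n; rewrite exprn_gt0.
- by move=> n; rewrite exprn_gt0.
- by move=> n; rewrite exprn_ge0 ?ltW.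
- move=> a a0; rewrite /marc_hi; case: ifPn => a1; last by left.
  have [n /andP[na an]] := exprn_bracket_oc bb1 a1.
  right; exists n => //; rewrite -powR_exprn ?(ltW b0)//.
  by apply: ge0_ler_powR; rewrite ?nnegrE ?exprn_ge0 ?(ltW b0) ?(ltW p0).
- move=> n; under eq_bigr => k _.
    rewrite exprS -mulrA -expr_div_n -powRB; last by rewrite bn0 implybT.
  over.
  rewrite -mulr_sumr ler_pM2l//; apply: sum_geometric_le.
  rewrite powR_ge0/= -[ltRHS](powRr0 b) /powR gt_eqF// ltr_expR.
  by rewrite ltr_pM2r ?ln_gt0// subr_lt0.
(* For [n = 0] the dilation is the identity, since [s = 1] may lie below [s0]; from [n = 1] on,
   [b^m >= s0] puts [s] in the range of [dil]. *)
- case=> [|n] f Ef.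
    rewrite !expr0 invr1 !mul1r (_ : dilation 1 f = f)//.
    by apply/funext => x; rewrite /dilation mul1r.
  have [|Edf Ndf] := dil ((b `^ m) ^+ n.+1) f _ Ef.
    by rewrite (le_trans bs)// ler_eXnr// b1m// ltW.
  split => //; rewrite (le_trans Ndf)// mul1r powR_exprn ?powR_ge0//.
  rewrite -exprMn -powRrM /rho -[X in (_ * X) ^+ _](powRr1 (ltW b0)) -powRD.
    by rewrite /e opprB subrK.
  by rewrite bn0 implybT.
Qed.

(** The mirror image with [q' < m < q]: jumps at [b^-(n+1)] of height [b^(-qn)], and
    [s_n = b^(-m(n+1))]. Now [m < q] gives summability and [m > q'] the decay, with
    [e = m / q' - 1]. Since the exponents start at [n + 1], every [s_n] is at most [s0] and the
    decay constant is [rho] instead of 1. *)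
Lemma sqb_marc_lo_le_distr (q q' s0 : R) : 0 < q' < q -> 0 < s0 ->
  (forall s f, 0 < s <= s0 -> E f ->
    E (dilation s^-1 f) /\ N (dilation s^-1 f) <= s `^ q'^-1 * N f) ->
  exists A : R, exists2 C : R, 0 <= C & forall f, E f -> exists g,
  [/\ E g, N g <= C * N f & forall w, 0 < w ->
    (\int[leb_pos]_x (marc_lo q%:E (`|f x| / w))%:E <=
      A%:E * distr leb_pos g w)%E].
Proof.
move=> /andP[q'0 q'q] s00 dil; pose m := (q + q') / 2; pose e := m / q' - 1.
have q0 : 0 < q := lt_trans q'0 q'q.
have mq : m < q by rewrite /m; lra.
have q'm : q' < m by rewrite /m; lra.
have m0 : 0 < m := lt_trans q'0 q'm.
have e0 : 0 < e by rewrite subr_gt0 ltr_pdivlMr// mul1r.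
have [b1 Hb1] := exists_powR_ge (2 * K) e0.
have [b2 Hb2] := exists_powR_ge s0^-1 m0.
pose b := Num.max 2 (Num.max b1 b2).
have b2' : 2 <= b by rewrite /b le_max lexx.
have b0 : 0 < b by exact: lt_le_trans b2'.
have bn0 : b != 0 by rewrite gt_eqF.
have bb1 : 1 < b by rewrite (lt_le_trans _ b2')// ltr1n.
have {Hb1} bK : 2 * K <= b `^ e by apply: Hb1; rewrite /b !le_max lexx !orbT.
have {Hb2} bs : s0^-1 <= b `^ m by apply: Hb2; rewrite /b !le_max lexx !orbT.
have bgt (x : R) : 0 < b `^ x by exact: powR_gt0.
have b1m (x : R) : 0 <= x -> 1 <= b `^ x.
  by move=> x0; rewrite -(powRr0 b) ler_powR// ltW.
have iv0 : 0 < b^-1 by rewrite invr_gt0.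
pose rho := b `^ (- e).
have Kr : K * rho < 1.
  rewrite /rho powRN ltr_pdivrMr// mul1r (lt_le_trans _ bK)//.
  by rewrite mulr_natl mulr2n ltrDl.
exists (b `^ m * (1 - b `^ (m - q))^-1).
apply: (@sqb_integral_le_distr _ _ _ EN _ rho K1 NK (bgt _) Kr _
  (fun n => b^-1 ^+ n.+1) (fun n => (b `^ m)^-1 ^+ n.+1)
  (fun n => (b `^ q)^-1 ^+ n) _ rho) => //.
- exact: measurable_marc_lo.
- exact: marc_lo_ge0.
- by move=> n; rewrite exprn_gt0.
- by move=> n; rewrite exprn_gt0 ?invr_gt0.
- by move=> n; rewrite exprn_ge0 ?invr_ge0 ?ltW.
- move=> a; rewrite /marc_lo le_eqVlt => /predU1P[<-|a0].
    by left; rewrite ltr10/= powR0// gt_eqF.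
  case: ltP => a1; first by left.
  (* A bracket of [a^-1] closed on the left inverts to [b^-(n+1) < a <= b^-n], strict at the jump as
     required. *)
  have [n /andP[na an]] : exists n : nat, b ^+ n <= a^-1 < b ^+ n.+1.
    by apply: exprn_bracket_co => //; rewrite invf_ge1.
  right; exists n.
    by rewrite exprVn invf_plt ?posrE ?exprn_gt0.
  rewrite exprVn -powR_exprn ?(ltW b0)// -powR_inv1 ?powR_ge0// -powRrM.
  rewrite mulrC powRrM powR_inv1 ?exprn_ge0 ?(ltW b0)//.
  apply: ge0_ler_powR; rewrite ?nnegrE ?invr_ge0 ?exprn_ge0 ?(ltW b0) ?(ltW q0)//.
    exact: ltW.
  by rewrite invf_pge ?posrE ?exprn_gt0.
- move=> n; under eq_bigr => k _.
    rewrite [X in _ / X]exprS invfM invrK mulrCA -exprVn invrK -exprMn.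
    rewrite [X in _ * X ^+ _]mulrC -powRB; last by rewrite bn0 implybT.
  over.
  rewrite -mulr_sumr ler_pM2l//; apply: sum_geometric_le.
  rewrite powR_ge0/= -[ltRHS](powRr0 b) /powR gt_eqF// ltr_expR.
  by rewrite ltr_pM2r ?ln_gt0// subr_lt0.
- exact/ltW/bgt.
- move=> n f Ef.
  have bi0 : 0 < (b `^ m)^-1 by rewrite invr_gt0.
  have [|Edf Ndf] := dil ((b `^ m)^-1 ^+ n.+1) f _ Ef.
    rewrite exprn_gt0//= (@le_trans _ _ (b `^ m)^-1)//.
      rewrite exprS ler_piMr ?(ltW bi0)// exprn_ile1 ?(ltW bi0)//.
      by rewrite invf_le1// b1m// ltW.
    by rewrite invf_ple ?posrE ?invr_gt0.
  split => //; rewrite (le_trans Ndf)// -exprS powR_exprn ?(ltW bi0)//.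
  rewrite -exprMn -powRN -powRrM /rho -(powR_inv1 (ltW b0)) -powRD.
    by rewrite /e opprB mulNr [1 - _]addrC addrK.
  by rewrite bn0 implybT.
Qed.

End dominated.
End boyd.

(** * Boundedness of Theta *)

Section theta_bounded.
Context {R : realType} {E : set (R -> R)} {N : (R -> R) -> R}.
Hypothesis EN : symmetric_quasi_banach E N.

Lemma integral_marcE (p : R) (q : \bar R) (f : R -> R) (w : R) :
  measurable_fun setT f ->
  (\int[leb_pos]_x (marc p q (f x / w))%:E =
   \int[leb_pos]_x (marc_hi p (f x / w))%:E +
   \int[leb_pos]_x (marc_lo q (f x / w))%:E)%E.
Proof.
move=> mf; have mfw : measurable_fun setT (fun x => f x / w).
  exact: measurable_funM.
rewrite -ge0_integralD//.
- by move=> x _; rewrite lee_fin marc_hi_ge0.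
- by apply/measurable_EFinP; apply: measurableT_comp mfw; exact: measurable_marc_hi.
- by move=> x _; rewrite lee_fin marc_lo_ge0.
- by apply/measurable_EFinP; apply: measurableT_comp mfw; exact: measurable_marc_lo.
Qed.

(** The two halves of [marc] give dominating functions [g1] and [g2], and [|g1| + |g2|] dominates
    both. The remaining multiple [A] of a distribution function is absorbed by [sqb_distr_mul],
    applied to the rearrangement of [Theta f], which is a function on the half-line. *)
Lemma Theta_bounded (p : R) (q : \bar R) : 0 < p -> (p%:E < q)%E ->
  [/\ (p%:E < boyd_lower E N)%E, (boyd_lower E N <= boyd_upper E N)%E,
      (boyd_upper E N < q)%E & (q < +oo)%E]
  \/ ((p%:E < boyd_lower E N)%E /\ q = +oo%E) ->
  exists2 c : R, 0 <= c & forall f, E f ->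
    quadrant_space E (Theta p%:E q f) /\
    quadrant_norm N (Theta p%:E q f) <= c * N f.
Proof.
move=> p0 pq Hpq.
have [K K1 NK] := sqb_quasi_triangle EN.
have pE : (p%:E < boyd_lower E N)%E by case: Hpq => -[].
have [p' pp' [s0 /(sqb_marc_hi_le_distr EN K1 NK p0 pp')]] :=
  boyd_lower_dilation EN p0 pE.
move=> [A1 [C1 C10 H1]].
have [A2 [C2 C20 H2]] : exists A : R, exists2 C : R, 0 <= C &
    forall f, E f -> exists g, [/\ E g, N g <= C * N f & forall w, 0 < w ->
    (\int[leb_pos]_x (marc_lo q (`|f x| / w))%:E <= A%:E * distr leb_pos g w)%E].
  case: Hpq => [[_ lu uq qy]|[_ ->]]; last first.
    exists 0, 1 => // f Ef; exists f; split => // [|w w0]; first by rewrite mul1r.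
    rewrite mul0e integral0_eq// => x _.
    by rewrite /marc_lo; case: ifP.
  have u0 : (0 < boyd_upper E N)%E.
    by apply: lt_le_trans lu; apply: lt_trans pE; rewrite lte_fin.
  case: q pq lu uq qy => [q| |]// pq lu uq _.
  have [q' q'q [s1 s10 dil]] := boyd_upper_dilation EN u0 uq.
  exact: (sqb_marc_lo_le_distr EN K1 NK q'q s10 dil).
(* [A1] and [A2] come without a sign. *)
pose A := Num.max A1 0 + Num.max A2 0.
have [c c0 Hc] := sqb_distr_mul EN A.
exists (c * (K * (C1 + C2))) => [|f Ef].
  by rewrite !mulr_ge0 ?addr_ge0 ?(le_trans _ K1).
have mf := sqb_measurable EN Ef.
have mF := measurable_Theta p%:E q mf.
have [g1 [Eg1 Ng1 Hg1]] := H1 f Ef; have [g2 [Eg2 Ng2 Hg2]] := H2 f Ef.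
have [Ea1 Na1] := sqb_norm EN Eg1; have [Ea2 Na2] := sqb_norm EN Eg2.
pose g x := `|g1 x| + `|g2 x|.
have Eg : E g := sqb_add EN Ea1 Ea2.
have mg := sqb_measurable EN Eg.
have dF w : 0 < w -> (distr leb_quadrant (Theta p%:E q f) w <= A%:E * distr leb_pos g w)%E.
  move=> w0; rewrite distr_Theta// integral_marcE; last exact: measurableT_comp.
  have max0 (x : R) : 0 <= Num.max x 0 by rewrite le_max lexx orbT.
  rewrite /A EFinD ge0_muleDl ?lee_fin//; apply: leeD.
    apply: (le_trans (Hg1 w w0)); apply: (@le_trans _ _ ((Num.max A1 0)%:E * distr leb_pos g1 w)%E).
      by apply: lee_wpmul2r; rewrite ?distr_ge0// lee_fin le_max lexx.
    apply: lee_wpmul2l; first by rewrite lee_fin.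
    apply: le_distr_fun => //; first exact: (sqb_measurable EN).
    by move=> x /lt_le_trans; apply; rewrite /g (ger0_norm (addr_ge0 _ _))// lerDl.
  apply: (le_trans (Hg2 w w0)); apply: (@le_trans _ _ ((Num.max A2 0)%:E * distr leb_pos g2 w)%E).
    by apply: lee_wpmul2r; rewrite ?distr_ge0// lee_fin le_max lexx.
  apply: lee_wpmul2l; first by rewrite lee_fin.
  apply: le_distr_fun => //; first exact: (sqb_measurable EN).
  by move=> x /lt_le_trans; apply; rewrite /g (ger0_norm (addr_ge0 _ _))// lerDr.
have SF : Sfun leb_quadrant (Theta p%:E q f).
  split => //; have [_ [v [v0 gv]]] := sqb_sub EN Eg; exists v; split => //.
  rewrite (le_lt_trans (dF v v0))// lte_mul_pinfty// lee_fin.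
  by rewrite addr_ge0// le_max lexx orbT.
have [EF NF] := Hc g (rearr_fun leb_quadrant (Theta p%:E q f)) Eg
  (measurable_rearr_fun _ _)
  (fun v v0 => le_trans (distr_rearr_fun_le SF v0) (dF v v0)).
split; first by split.
rewrite /quadrant_norm (le_trans NF)// -mulrA ler_wpM2l// (le_trans (NK _ _ Ea1 Ea2))//.
rewrite -mulrA ler_wpM2l ?(le_trans _ K1)// mulrDl.
by rewrite lerD// ?(le_trans Na1) ?(le_trans Na2).
Qed.

End theta_bounded.

(** * Weak type bounds and the splitting of [f] *)

Section weak_type.
Context {R : realType}.
Implicit Types (f g h : R -> R) (T : (R -> R) -> (R -> R)).

(** Otherwise some [t] lies strictly between the two sides; the rearrangement at [t] is then at
    least [v], so [t^(1/r) v <= M], against [t > (M / v)^r]. *)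
Lemma distr_le_weakLnorm d (X : measurableType d) (mu : {measure set X -> \bar R})
    (g : X -> R) (r M v : R) : 0 < r -> 0 <= M -> 0 < v ->
  measurable_fun setT g -> (weakLnorm mu r%:E g <= M%:E)%E ->
  (distr mu g v <= ((M / v) `^ r)%:E)%E.
Proof.
move=> r0 M0 v0 mg gM; rewrite leNgt; apply/negP => /lte_dense_fin[t Mt tg].
have t0 : 0 < t by apply: le_lt_trans Mt; exact: powR_ge0.
have : ((t `^ r^-1)%:E * rearr mu g t <= M%:E)%E.
  by apply: le_trans gM; apply: ereal_sup_ubound; exists t.
have tr0 : 0 < t `^ r^-1 by exact: powR_gt0.
move=> /(le_trans (lee_wpmul2l _ (le_rearr mg tg))).
rewrite lee_fin => /(_ (ltW tr0)); rewrite -EFinM lee_fin -ler_pdivlMr//.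
move=> tM; move: Mt; rewrite ltNge => /negP; apply.
have {1}-> : t = (t `^ r^-1) `^ r by rewrite -powRrM mulVf ?gt_eqF// powRr1// ltW.
by apply: ge0_ler_powR; rewrite ?nnegrE ?powR_ge0 ?divr_ge0 ?(ltW v0)// ltW.
Qed.

Lemma Lnorm_EFin_powR d (X : measurableType d) (mu : {measure set X -> \bar R})
    (g : X -> R) (r : R) : 0 < r ->
  ('N[mu]_r%:E[EFin \o g] `^ r = \int[mu]_x (`|g x| `^ r)%:E)%E.
Proof. by move=> r0; rewrite poweR_Lnorm ?gt_eqF. Qed.

Lemma LspcP d (X : measurableType d) (mu : {measure set X -> \bar R})
    (g : X -> R) (r : R) : 0 < r -> measurable_fun setT g ->
  (\int[mu]_x (`|g x| `^ r)%:E < +oo)%E -> Lspc mu r%:E g.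
Proof.
move=> r0 mg gr; split => //; apply: (@lty_poweRy _ _ r); first by rewrite gt_eqF.
by rewrite Lnorm_EFin_powR.
Qed.

(** Normalised so that the level cancels: the norm of [h] is [(v / D) M^(1/r)], hence the weak
    quasi-norm of [T h] is at most [v M^(1/r)], and the distribution bound at [v] is exactly [M]. *)
Lemma weak_type_distr (r C D M v : R) T h : 0 < r -> 0 < D -> C <= D -> 0 < v ->
  0 <= M -> weak_type leb_pos r%:E C T -> measurable_fun setT h -> nonneg h ->
  measurable_fun setT (T h) ->
  (\int[leb_pos]_x (`|h x| `^ r)%:E = ((v / D) `^ r * M)%:E)%E ->
  (distr leb_pos (T h) v <= M%:E)%E.
Proof.
move=> r0 D0 CD v0 M0 wT mh h0 mTh hr.
have vD0 : 0 <= v / D by rewrite divr_ge0// ltW.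
have Lh : Lspc leb_pos r%:E h by apply: LspcP => //; rewrite hr ltry.
have Nh : ('N[leb_pos]_r%:E[EFin \o h] = (v / D * M `^ r^-1)%:E)%E.
  have := Lnorm_EFin_powR leb_pos h r0; rewrite hr.
  move=> /(congr1 (fun x => x `^ r^-1)%E).
  rewrite -poweRrM mulfV ?gt_eqF// poweRe1 ?Lnorm_ge0// => ->.
  rewrite poweR_EFin powRM ?powR_ge0// -powRrM mulfV ?gt_eqF//.
  by rewrite powRr1.
have := wT h (conj Lh h0); rewrite Nh => wTh.
have : (weakLnorm leb_pos r%:E (T h) <= (v * M `^ r^-1)%:E)%E.
  rewrite (le_trans wTh)// lee_fin mulrA ler_wpM2r ?powR_ge0//.
  by rewrite mulrCA ler_piMr ?(ltW v0)// ler_pdivrMr// mul1r.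
have vM0 : 0 <= v * M `^ r^-1 by rewrite mulr_ge0 ?powR_ge0 ?(ltW v0).
move=> /(@distr_le_weakLnorm _ _ leb_pos _ _ _ _ r0 vM0 v0 mTh) dT.
apply: le_trans dT _.
have -> : v * M `^ r^-1 / v = M `^ r^-1 by rewrite mulrAC divff ?gt_eqF// mul1r.
by rewrite lee_fin -powRrM mulVf ?gt_eqF// powRr1.
Qed.

(** The norm of exponent [+oo] unfolds to an essential supremum only on a space of positive
    measure. *)
Lemma leb_posT_gt0 : (0 < @leb_pos R setT)%E.
Proof.
rewrite leb_posE setTI lebesgue_measure_itv/= ltry.
by rewrite ?oppr0 ?adde0.
Qed.

Lemma Lspcy_bounded (b : R) h : measurable_fun setT h ->
  (forall x, `|h x| <= b) -> ('N[leb_pos]_+oo[EFin \o h] <= b%:E)%E.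
Proof.
move=> mh hb; rewrite unlock /Lnorm leb_posT_gt0.
by apply/ess_supP; apply: aeW => x /=; rewrite lee_fin.
Qed.

Lemma weak_typey_distr (C D v : R) T h : 0 < D -> C <= D -> 0 < v ->
  weak_type leb_pos +oo%E C T -> measurable_fun setT h -> nonneg h ->
  measurable_fun setT (T h) -> (forall x, `|h x| <= v / D) ->
  distr leb_pos (T h) v = 0%E.
Proof.
move=> D0 CD v0 wT mh h0 mTh hb.
have Nh := Lspcy_bounded mh hb.
have Lh : Lspc leb_pos +oo%E h by split => //; rewrite (le_lt_trans Nh)// ltry.
have : ('N[leb_pos]_+oo[EFin \o T h] <= v%:E)%E.
  apply: (le_trans (wT h (conj Lh h0))).
  apply: (@le_trans _ _ (D%:E * 'N[leb_pos]_+oo[EFin \o h])%E).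
    by apply: lee_wpmul2r; rewrite ?Lnorm_ge0// lee_fin.
  rewrite (_ : v%:E = D%:E * (v / D)%:E)%E; last first.
    by rewrite -EFinM mulrC divfK// gt_eqF.
  by apply: lee_wpmul2l; rewrite ?lee_fin ?(ltW D0).
rewrite unlock /Lnorm leb_posT_gt0 => /ess_supP [Z [mZ Z0 subZ]].
apply: (@subset_measure0 _ _ _ leb_pos _ Z) => //; first exact: measurable_distr_set.
by move=> x /= vx; apply: subZ => /=; apply/negP; rewrite lee_fin -ltNge.
Qed.

Section splitting.
Variables (p : R) (q : \bar R) (Cp Cq C : R) (T : (R -> R) -> (R -> R)).
Hypothesis p0 : 0 < p.
Hypothesis pq : (p%:E < q)%E.
Hypothesis opT : operator_on leb_pos (sum_cone leb_pos p%:E q) T.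
Hypothesis scT : subconvex leb_pos (sum_cone leb_pos p%:E q) (fun f x => `|T f x|).
Hypothesis wp : weak_type leb_pos p%:E Cp T.
Hypothesis wq : weak_type leb_pos q Cq T.
Hypothesis C0 : 0 < C.
Hypothesis CpC : Cp <= C.
Hypothesis CqC : Cq <= C.

Let q0 : (0 < q)%E. Proof. by apply: lt_trans pq; rewrite lte_fin. Qed.

Let Lspc0 (r : \bar R) : (0 < r)%E -> Lspc leb_pos r (cst 0) /\ nonneg (cst 0 : R -> R).
Proof.
move=> r0; split => //; split => //.
rewrite (_ : EFin \o _ = cst 0%E)// Lnorm0 ?ltry// gt_eqF//.
Qed.

Let sum_cone_hi h : Lspc leb_pos p%:E h -> nonneg h -> sum_cone leb_pos p%:E q h.
Proof.
move=> Lh h0; exists h, (cst 0); split => //; first exact: Lspc0.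
by apply/funext => x /=; rewrite addr0.
Qed.

Let sum_cone_lo h : Lspc leb_pos q h -> nonneg h -> sum_cone leb_pos p%:E q h.
Proof.
move=> Lh h0; exists (cst 0), h; split => //; first by apply: Lspc0; rewrite lte_fin.
by apply/funext => x /=; rewrite add0r.
Qed.

(** The factor [c] has two uses: with [c = 1] the parts add up to [f] and place it in the cone, with
    [c = 2] they have [f] as midpoint. *)
Let hi_part f (w c x : R) : R := if 1 < f x / w then c * f x else 0.
Let lo_part f (w c x : R) : R := if 1 < f x / w then 0 else c * f x.

(** Finiteness of the integral puts the upper part in the space of exponent [p] and the lower part
    in that of exponent [q]; this is what places [f] in the domain of [T]. *)
Lemma subconvex_distr_le f v : measurable_fun setT f -> nonneg f -> 0 < v ->
  (\int[leb_pos]_x (marc p q (f x / (v / (2 * C))))%:E < +oo)%E ->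
  sum_cone leb_pos p%:E q f /\
  (distr leb_pos (T f) v <=
    \int[leb_pos]_x (marc p q (f x / (v / (2 * C))))%:E)%E.
Proof.
move=> mf f0 v0; set w := v / (2 * C).
have C20 : 0 < 2 * C by rewrite mulr_gt0.
have w0 : 0 < w by rewrite divr_gt0.
(* The 2 in [w] matches the doubling of the parts: for finite [r] the [r]-th power integral of a
   doubled part is [(2 w)^r = (v / C)^r] times [I1] or [I2], the normalisation of
   [weak_type_distr]. *)
have vC : v / C = 2 * w by rewrite /w; field; rewrite gt_eqF.
have mfw : measurable_fun setT (fun x => f x / w) by exact: measurable_funM.
have mif : measurable_fun setT (fun x => 1 < f x / w) by exact: measurable_fun_ltr.
have mhi c : measurable_fun setT (hi_part f w c).
  by apply: measurable_fun_ifT => //; exact: measurable_funM.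
have mlo c : measurable_fun setT (lo_part f w c).
  by apply: measurable_fun_ifT => //; exact: measurable_funM.
have hi0 c : 0 <= c -> nonneg (hi_part f w c).
  by move=> c0 x; rewrite /hi_part; case: ifP => // _; rewrite mulr_ge0.
have lo0 c : 0 <= c -> nonneg (lo_part f w c).
  by move=> c0 x; rewrite /lo_part; case: ifP => // _; rewrite mulr_ge0.
rewrite integral_marcE//.
set I1 := (X in (X + _)%E); set I2 := (X in (_ + X)%E) => I12.
have I10 : (0 <= I1)%E by apply: integral_ge0 => x _; rewrite lee_fin marc_hi_ge0.
have I20 : (0 <= I2)%E by apply: integral_ge0 => x _; rewrite lee_fin marc_lo_ge0.
have I1fin : (I1 < +oo)%E by apply: le_lt_trans I12; rewrite leeDl.
have I2fin : (I2 < +oo)%E by apply: le_lt_trans I12; rewrite leeDr.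
have I1E : I1 = (fine I1)%:E by rewrite fineK// ge0_fin_numE.
have I2E : I2 = (fine I2)%:E by rewrite fineK// ge0_fin_numE.
have fw0 x : 0 <= f x / w by apply: divr_ge0; [exact: f0|exact: ltW].
have mHI : measurable_fun setT (fun x => (marc_hi p (f x / w))%:E).
  by apply/measurable_EFinP; apply: measurableT_comp mfw; exact: measurable_marc_hi.
have mLO (r : \bar R) : measurable_fun setT (fun x => (marc_lo r (f x / w))%:E).
  by apply/measurable_EFinP; apply: measurableT_comp mfw; exact: measurable_marc_lo.
have hip c : 0 <= c ->
    (\int[leb_pos]_x (`|hi_part f w c x| `^ p)%:E = ((c * w) `^ p * fine I1)%:E)%E.
  move=> c0; have cw0 : 0 <= c * w by rewrite mulr_ge0 ?(ltW w0).
  rewrite EFinM -I1E -ge0_integralZl//.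
  - apply: eq_integral => x _; rewrite -EFinM; congr EFin.
    rewrite /hi_part /marc_hi; case: ifP => _; last by rewrite normr0 powR0 ?gt_eqF ?mulr0.
    rewrite ger0_norm ?mulr_ge0// -powRM ?cw0 ?fw0//.
    by rewrite -mulrA [w * _]mulrC divfK// gt_eqF.
  - by move=> x _; rewrite lee_fin marc_hi_ge0.
  - by rewrite lee_fin powR_ge0.
have Lhi c : 0 <= c -> Lspc leb_pos p%:E (hi_part f w c).
  move=> c0; have := ltry ((c * w) `^ p * fine I1).
  by rewrite -(hip c c0) => H; apply: LspcP; [exact: p0|exact: mhi|exact: H].
(* Measurability of [T] on the lower part is left as a premise: it comes from membership in the
   cone, which rests on the first component. *)
have lodistr : (forall c, 0 <= c -> Lspc leb_pos q (lo_part f w c)) /\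
    (measurable_fun setT (T (lo_part f w 2)) ->
      distr leb_pos (T (lo_part f w 2)) v <= I2)%E.
  move: I20 I2fin I2E; rewrite {I12}/I2; move: pq q0 wq.
  case: q => [r| |] // pr r0 wr; set J2 := (\int[leb_pos]_x _)%E => I20 I2fin I2E.
    rewrite lte_fin in r0.
    have lor c : 0 <= c ->
        (\int[leb_pos]_x (`|lo_part f w c x| `^ r)%:E = ((c * w) `^ r * fine J2)%:E)%E.
      move=> c0; have cw0 : 0 <= c * w by rewrite mulr_ge0 ?(ltW w0).
      rewrite EFinM -I2E -ge0_integralZl//.
      - apply: eq_integral => x _; rewrite -EFinM; congr EFin.
        rewrite /lo_part /marc_lo; case: ifP => _; first by rewrite normr0 powR0 ?gt_eqF ?mulr0.
        rewrite ger0_norm ?mulr_ge0// -powRM ?cw0 ?fw0//.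
        by rewrite -mulrA [w * _]mulrC divfK// gt_eqF.
      - exact: mLO.
      - by move=> x _; rewrite lee_fin marc_lo_ge0.
      - by rewrite lee_fin powR_ge0.
    split=> [c c0|mT].
      have := ltry ((c * w) `^ r * fine J2).
      by rewrite -(lor c c0) => H; apply: LspcP; [exact: r0|exact: mlo|exact: H].
    rewrite I2E; apply: (weak_type_distr r0 C0 CqC) => //.
    - by rewrite fine_ge0.
    - exact: lo0.
    - by rewrite vC; exact: lor.
  have lob c : 0 <= c -> forall x, `|lo_part f w c x| <= c * w.
    move=> c0 x; rewrite ger0_norm ?lo0// /lo_part.
    case: ltP => [_|]; first by rewrite mulr_ge0// ltW.
    by rewrite ler_pdivrMr// mul1r => fw; rewrite ler_wpM2l.
  split=> [c c0|mT].
    split; first exact: mlo.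
    apply: (@le_lt_trans _ _ (c * w)%:E); last exact: ltry.
    by apply: Lspcy_bounded; [exact: mlo|exact: lob].
  rewrite (weak_typey_distr C0 CqC v0 wr)//; first exact: lo0.
  by move=> x; rewrite vC; exact: lob.
have [Llo dlo] := lodistr.
have fE : f = hi_part f w 1 \+ lo_part f w 1.
  apply/funext => x; rewrite /hi_part /lo_part /=.
  by case: ifP => _; rewrite ?addr0 ?add0r mul1r.
have Df : sum_cone leb_pos p%:E q f.
  exists (hi_part f w 1), (lo_part f w 1); split => //.
    by split; [exact: Lhi|exact: hi0].
  by split; [exact: Llo|exact: lo0].
have Dhi : sum_cone leb_pos p%:E q (hi_part f w 2).
  by apply: sum_cone_hi; [exact: Lhi|exact: hi0].
have Dlo : sum_cone leb_pos p%:E q (lo_part f w 2).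
  by apply: sum_cone_lo; [exact: Llo|exact: lo0].
have mT h : sum_cone leb_pos p%:E q h -> measurable_fun setT (T h).
  by move=> /opT.1 [].
split => //.
have dhi : (distr leb_pos (T (hi_part f w 2)) v <= I1)%E.
  rewrite I1E; apply: (weak_type_distr p0 C0 CpC) => //.
  - by rewrite fine_ge0.
  - exact: hi0.
  - exact: mT.
  - by rewrite vC; exact: hip.
(* A midpoint above [v] forces one endpoint above [v], so the level set of [T f] is a.e. inside the
   union of the two others, with no loss in the height. *)
pose g x := Num.max `|T (hi_part f w 2) x| `|T (lo_part f w 2) x|.
have mg : measurable_fun setT g.
  by apply: measurable_maxr; apply: measurableT_comp => //; exact: mT.
have gE x : (v < `|g x|) =
    (v < `|T (hi_part f w 2) x|) || (v < `|T (lo_part f w 2) x|).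
  by rewrite ger0_norm /g ?le_max ?normr_ge0// lt_max.
have Tfg : (distr leb_pos (T f) v <= distr leb_pos g v)%E.
  apply: le_distr_ae => //; first exact: mT.
  have half01 : 0 <= (2^-1 : R) <= 1 by lra.
  have := scT Dhi Dlo half01.
  rewrite (_ : (fun y => _) = f); last first.
    apply/funext => y; rewrite /hi_part /lo_part; case: ifP => _; lra.
  apply: (@filterS _ _ (ae_filter_ringOfSetsType leb_pos)) => x Tx vx.
  by rewrite gE; apply/orP; have [h|h] := ltP v `|T (hi_part f w 2) x|; [left|right]; lra.
rewrite (le_trans Tfg)//.
apply: (@le_trans _ _ (distr leb_pos (T (hi_part f w 2)) v +
   distr leb_pos (T (lo_part f w 2)) v)%E); last first.
  by rewrite leeD// dlo//; exact: mT.
rewrite /distr (_ : [set x | _] = [set x | v < `|T (hi_part f w 2) x|] `|`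
  [set x | v < `|T (lo_part f w 2) x|]).
  by apply: measureU2; apply: measurable_distr_set; exact: mT.
by apply/seteqP; split => x /=; rewrite gE => /orP.
Qed.

End splitting.
End weak_type.

(** Tested on the indicator of []0, 1[], which has norm 1. This gives [max Cp Cq >= 0]. *)
Lemma weak_type_ge0 (R : realType) (p C : R) (T : (R -> R) -> (R -> R)) :
  0 < p -> weak_type leb_pos p%:E C T -> 0 <= C.
Proof.
move=> p0 wT; pose h : R -> R := \1_(`]0, 1[ : set R).
have mh : measurable_fun setT h by exact: measurable_indic.
have hp : (\int[leb_pos]_x (`|h x| `^ p)%:E = 1)%E.
  transitivity (leb_pos (`]0, 1[ : set R)); last exact: leb_pos_itv.
  rewrite -[X in leb_pos X]setIT -integral_indic//.
  apply: eq_integral => x _; rewrite /h indicE; case: (_ \in _) => /=.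
    by rewrite normr1 powR1.
  by rewrite normr0 powR0 ?gt_eqF.
have Nh : 'N[leb_pos]_p%:E[EFin \o h]%E = 1%E.
  have := Lnorm_EFin_powR leb_pos h p0; rewrite hp.
  move=> /(congr1 (fun x => x `^ p^-1)%E).
  by rewrite -poweRrM mulfV ?gt_eqF// poweRe1 ?Lnorm_ge0// poweR1r.
have Lh : Lspc leb_pos p%:E h /\ nonneg h.
  by split; [split => //; rewrite Nh ltry|move=> x; rewrite /h indicE].
have := wT h Lh; rewrite Nh mule1 => wTh; rewrite -lee_fin (le_trans _ wTh)//.
apply: (@le_trans _ _ ((1 `^ p^-1)%:E * rearr leb_pos (T h) 1)%E).
  by rewrite mule_ge0 ?rearr_ge0// lee_fin powR_ge0.
by apply: ereal_sup_ubound; exists 1 => //=.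
Qed.

(** * Interpolation in a symmetric space *)

Section interpolation.
Context {R : realType} {E : set (R -> R)} {N : (R -> R) -> R}.
Hypothesis EN : symmetric_quasi_banach E N.
Variables (p : R) (q : \bar R) (Cp Cq : R) (T : (R -> R) -> (R -> R)).
Hypothesis p0 : 0 < p.
Hypothesis pq : (p%:E < q)%E.
Hypothesis opT : operator_on leb_pos (sum_cone leb_pos p%:E q) T.
Hypothesis scT : subconvex leb_pos (sum_cone leb_pos p%:E q) (fun f x => `|T f x|).
Hypothesis wp : weak_type leb_pos p%:E Cp T.
Hypothesis wq : weak_type leb_pos q Cq T.
Hypothesis index : [/\ (p%:E < boyd_lower E N)%E, (boyd_lower E N <= boyd_upper E N)%E,
      (boyd_upper E N < q)%E & (q < +oo)%E]
  \/ ((p%:E < boyd_lower E N)%E /\ q = +oo%E).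

(** [Theta f] lives on the quadrant, so [(2 C)^-1 T f] is compared with it through distribution
    functions and then with [rearr_fun] of it, an element of [E]; symmetry applies there and
    homogeneity restores [2 C]. *)
Lemma interpolation_gt0 (C : R) f : 0 < C -> Cp <= C -> Cq <= C -> E f -> nonneg f ->
  E (T f) /\ N (T f) <= 2 * Theta_norm p%:E q E N * C * N f.
Proof.
move=> C0 CpC CqC Ef f0; have mf := sqb_measurable EN Ef.
have [c c0 Hc] := Theta_bounded EN p0 pq index.
have [[SF EF] NF] := opnormP c0 (sqb_norm_ge0 EN) Hc Ef.
set F := Theta p%:E q f in SF EF NF.
have C20 : 0 < 2 * C by rewrite mulr_gt0.
have dFE w : 0 < w ->
    distr leb_quadrant F w = (\int[leb_pos]_x (marc p q (f x / w))%:E)%E.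
  move=> w0; rewrite /F (distr_Theta p0 pq w0 mf); apply: eq_integral => x _.
  by rewrite ger0_norm.
have key v : 0 < v -> (distr leb_quadrant F (v / (2 * C)) < +oo)%E ->
    sum_cone leb_pos p%:E q f /\
    (distr leb_pos (T f) v <= distr leb_quadrant F (v / (2 * C)))%E.
  move=> v0; rewrite dFE ?divr_gt0// => Ioo.
  exact: (subconvex_distr_le p0 pq opT scT wp wq C0 CpC CqC).
have [_ [w [w0 Fw]]] := SF.
(* One height at which [F] has finite distribution already puts [f] in the domain of [T]. *)
have ST : Sfun leb_pos (T f).
  apply: opT.1; have := key (w * (2 * C)) (mulr_gt0 w0 C20).
  by rewrite mulfK ?gt_eqF// => /(_ Fw)[].
have mT : measurable_fun setT (T f) by case: ST.
pose g x := (2 * C)^-1 * T f x.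
have mg : measurable_fun setT g by exact: measurable_funM.
have dg v : 0 < v -> (distr leb_pos g v <= distr leb_quadrant F v)%E.
  move=> v0; have [->|] := eqVneq (distr leb_quadrant F v) +oo%E; first exact: leey.
  rewrite -ltey => Fv.
  have v20 : 0 < v * (2 * C) by rewrite mulr_gt0.
  have := key (v * (2 * C)) v20; rewrite mulfK ?gt_eqF// => /(_ Fv)[_].
  apply: le_trans; apply: le_distr_fun => // x.
  by rewrite /g normrM gtr0_norm ?invr_gt0// mulrC ltr_pdivlMr.
have [Eg Ng] : E g /\ N g <= N (rearr_fun leb_quadrant F).
  apply: (sqb_symmetric EN) => //.
    by split => //; exists w; split => //; rewrite (le_lt_trans (dg w w0)).
  move=> t t0; apply: (le_trans (rearr_le_distr t dg)).
  exact: rearr_le_rearr_fun.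
rewrite (_ : T f = fun x => (2 * C) * g x); last first.
  by apply/funext => x; rewrite /g mulrA divff ?mul1r// gt_eqF.
split; first exact: (sqb_scale EN).
rewrite (sqb_norm_scale EN)// gtr0_norm// (_ : 2 * _ * C = 2 * C * Theta_norm p%:E q E N).
  by rewrite -mulrA ler_pM2l// (le_trans Ng).
by ring.
Qed.

(** The splitting height requires [C > 0]. If [max Cp Cq = 0], the bound holds for every positive
    [C], and letting [C] tend to 0 gives [N (T f) = 0]. *)
Lemma interpolation f : E f -> nonneg f ->
  E (T f) /\ N (T f) <= 2 * Theta_norm p%:E q E N * Num.max Cp Cq * N f.
Proof.
move=> Ef f0; have Cp0 := weak_type_ge0 p0 wp.
have : 0 <= Num.max Cp Cq by rewrite le_max Cp0.
have CpM : Cp <= Num.max Cp Cq by rewrite le_max lexx.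
have CqM : Cq <= Num.max Cp Cq by rewrite le_max lexx orbT.
rewrite le_eqVlt => /predU1P[M0|M0]; last exact: interpolation_gt0.
have H C : 0 < C -> E (T f) /\ N (T f) <= 2 * Theta_norm p%:E q E N * C * N f.
  by move=> C0; apply: interpolation_gt0 => //; apply: ltW; apply: le_lt_trans C0; rewrite M0.
split; first exact: (H 1 ltr01).1.
rewrite -M0 mulr0 mul0r; apply/ler_addgt0Pr => e e0; rewrite add0r.
set B := 2 * Theta_norm p%:E q E N in H.
have B0 : 0 <= B by rewrite mulr_ge0// opnorm_ge0.
have Nf0 := sqb_norm_ge0 EN Ef.
have BN : 0 < B * N f + 1 by rewrite ltr_wpDl// mulr_ge0.
have := (H (e / (B * N f + 1)) (divr_gt0 e0 BN)).2 => /le_trans; apply.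
rewrite mulrAC mulrA ler_pdivrMr// mulrC ler_pM2l//.
by rewrite lerDl.
Qed.

End interpolation.

(** * Growth of Orlicz functions *)

Section orlicz_growth.
Context {R : realType} {Phi : R -> \bar R}.
Hypothesis oPhi : orlicz_function Phi.
Hypothesis d2Phi : Delta2 Phi.

Let F (x : R) := fine (Phi x).

Lemma Delta2_exprn : exists2 C : R, 0 < C & forall n t, 0 <= t ->
  (Phi (2 ^+ n * t)%R <= (C ^+ n)%:E * Phi t)%E.
Proof.
have [C [C0 HC]] := d2Phi; exists C => //; elim=> [|n IH] t t0.
  by rewrite !expr0 mul1r mul1e.
rewrite exprS -mulrA; apply: (le_trans (HC _ _)).
  by rewrite mulr_ge0// exprn_ge0.
by rewrite exprS EFinM -muleA; apply: lee_wpmul2l; [rewrite lee_fin ltW|exact: IH].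
Qed.

(** Continuity at 0 gives one positive point with a finite value, and the doubling condition
    propagates finiteness. *)
Lemma orlicz_lty x : 0 <= x -> (Phi x < +oo)%E.
Proof.
move=> x0; have [C C0 HC] := Delta2_exprn.
have [e e0 He] : exists2 e : R, 0 < e & (Phi e < +oo)%E.
  have /subspace_continuousP/(_ 0) := orlicz_cont oPhi.
  rewrite /= in_itv/= lexx/= orlicz_0// => /(_ isT).
  move=> /(_ _ (open_ereal_lt' lte01)) [e /= e0 He]; exists (e / 2).
    by rewrite divr_gt0.
  apply: (lt_trans (y := 1%E)); last exact: ltry.
  apply: He; rewrite /ball_/= ?in_itv/= ?andbT; last by rewrite divr_ge0// ltW.
  by rewrite sub0r normrN gtr0_norm ?divr_gt0// ltr_pdivrMr// ltr_pMr// ltr1n.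
have [n xn] := exists_exprn_gt (x / e) (ltr1n R 2).
apply: (@le_lt_trans _ _ (Phi (2 ^+ n * e)%R)).
  by apply: (orlicz_incr oPhi) => //; rewrite -ler_pdivrMr// ltW.
apply: (le_lt_trans (HC n e (ltW e0))); rewrite lte_mul_pinfty//.
by rewrite lee_fin exprn_ge0// ltW.
Qed.

Lemma orlicz_fineE x : 0 <= x -> Phi x = (F x)%:E.
Proof.
move=> x0; rewrite /F fineK// ge0_fin_numE ?(orlicz_ge0 oPhi)//.
exact: orlicz_lty.
Qed.

Lemma fine_orlicz_ge0 x : 0 <= x -> 0 <= F x.
Proof. by move=> x0; apply: fine_ge0; exact: (orlicz_ge0 oPhi). Qed.

Lemma fine_orlicz_le x y : 0 <= x -> x <= y -> F x <= F y.
Proof.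
move=> x0 xy; rewrite -lee_fin -!orlicz_fineE//; first exact: (orlicz_incr oPhi).
exact: le_trans xy.
Qed.

(** A zero at some [x > 0] would spread to the whole half-line by doubling, against the limit at
    infinity. *)
Lemma fine_orlicz_gt0 x : 0 < x -> 0 < F x.
Proof.
move=> x0; rewrite lt_neqAle fine_orlicz_ge0 ?ltW// andbT eq_sym; apply/eqP => Fx.
have [C C0 HC] := Delta2_exprn.
have Phix : Phi x = 0%E by rewrite (orlicz_fineE (ltW x0)) Fx.
have Phi0 y : 0 <= y -> Phi y = 0%E.
  move=> y0; have [n yn] := exists_exprn_gt (y / x) (ltr1n R 2).
  apply/eqP; rewrite eq_le (orlicz_ge0 oPhi)// andbT.
  apply: (@le_trans _ _ (Phi (2 ^+ n * x)%R)).
    by apply: (orlicz_incr oPhi) => //; rewrite -ler_pdivrMr// ltW.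
  by apply: (le_trans (HC n x (ltW x0))); rewrite Phix mule0.
have := orlicz_lim oPhi => /cvgeyPge/(_ 1) [M [_ HM]].
pose y := Num.max 0 M + 1.
have y0 : 0 <= y by rewrite addr_ge0// le_max lexx.
have My : M < y by rewrite ltr_pwDr// le_max lexx orbT.
by have := HM y My; rewrite Phi0// lee_fin ler10.
Qed.

Lemma fine_orlicz_scale (B : R) : 0 <= B -> exists2 c : R, 0 < c &
  forall a, 0 <= a -> F (B * a) <= c * F a.
Proof.
move=> B0; have [C C0 HC] := Delta2_exprn.
have [n Bn] := exists_exprn_gt B (ltr1n R 2).
exists (C ^+ n) => [|a a0]; first by rewrite exprn_gt0.
rewrite -lee_fin EFinM -!orlicz_fineE//; last by rewrite mulr_ge0.
apply: le_trans (HC n a a0); apply: (orlicz_incr oPhi); first by rewrite mulr_ge0.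
by rewrite ler_wpM2r// ltW.
Qed.

Lemma orlicz_M_ge t s : 0 < t -> 0 < s -> ((F (t * s) / F s)%:E <= orlicz_M Phi t)%E.
Proof.
move=> t0 s0; apply: ereal_sup_ubound; exists s => //.
rewrite !orlicz_fineE ?ltW ?mulr_gt0// inver gt_eqF ?fine_orlicz_gt0//.
Qed.

(** Near 0 one has [ln t < 0], so a quotient above [p'] says that [orlicz_M] is at most [t^p']. An
    infinite [orlicz_M] would make the quotient [-oo] and is excluded. *)
Lemma orlicz_lower_growth (p : R) : 0 < p -> (p%:E < orlicz_lower Phi)%E ->
  exists2 p' : R, p < p' & exists2 e : R, 0 < e < 1 &
  forall t s, 0 < t <= e -> 0 < s -> F (t * s) <= t `^ p' * F s.
Proof.
move=> p0 /lte_dense_fin[p' pp' p'E]; exists p' => //.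
have p'0 : 0 < p' := lt_trans p0 pp'.
have : (0 < orlicz_lower Phi)%E by apply: lt_trans p'E.
move=> /lim_gt0_cvg /(_ _ (open_ereal_gt' p'E)) [e /= e0 He].
exists (Num.min (e / 2) 2^-1).
  rewrite lt_min divr_gt0//= invr_gt0 ltr0n/= gt_min invf_lt1// ltr1n orbT//.
move=> t s /andP[t0]; rewrite le_min => /andP[te t2] s0.
have lnt : ln t < 0 by rewrite ln_lt0// t0/= (le_lt_trans t2)// invf_lt1// ltr1n.
have Ht : ball_ Num.norm 0 e t.
  by rewrite /ball_ /= sub0r normrN gtr0_norm//; lra.
have {He} := He t Ht t0.
have := orlicz_M_ge t0 s0; case: (orlicz_M Phi t) => [r| |]//.
  rewrite lee_fin ler_pdivrMr ?fine_orlicz_gt0// => /le_trans rF pr; apply: rF.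
  rewrite ler_wpM2r ?fine_orlicz_ge0 ?(ltW s0)//.
  have [r0|r0] := leP r 0; first by rewrite (le_trans r0)// powR_ge0.
  apply: ln_le_powR => //; first exact: ltW.
  move: pr; rewrite lne_EFin// inver lt_eqF// -EFinM lte_fin.
  by rewrite ltr_ndivlMr// => /ltW.
by move=> _; rewrite inver lt_eqF// [lne _]/= lt0_mulye// lte_fin invr_lt0.
Qed.

Lemma orlicz_upper_growth (q : R) : (0 < orlicz_upper Phi)%E ->
  (orlicz_upper Phi < q%:E)%E ->
  exists2 q' : R, 0 < q' < q & exists2 X : R, 1 < X &
  forall t s, X <= t -> 0 < s -> F (t * s) <= t `^ q' * F s.
Proof.
move=> u0 uq.
have [q' uq' q'q] : exists2 q' : R, (orlicz_upper Phi < q'%:E)%E & q' < q.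
  move: u0 uq; case: (orlicz_upper Phi) => [r| |]//; rewrite !lte_fin => r0 rq.
  by exists ((r + q) / 2); rewrite ?lte_fin midf_lt.
have q'0 : 0 < q' by rewrite -lte_fin; exact: lt_trans uq'.
exists q'; first by rewrite q'0.
have uc : (lne (orlicz_M Phi t) / (ln t)%:E)%E @[t --> +oo] --> orlicz_upper Phi.
  exact: lim_gt0_cvg.
have [M [_ HM]] := uc _ (open_ereal_lt' uq').
exists (Num.max 2 (M + 1)); first by rewrite lt_max ltr1n.
move=> t s; rewrite ge_max => /andP[t2 tM] s0.
have t0 : 0 < t by exact: lt_le_trans t2.
have lnt : 0 < ln t by rewrite ln_gt0// (lt_le_trans _ t2)// ltr1n.
have {HM} : (lne (orlicz_M Phi t) / (ln t)%:E < q'%:E)%E.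
  by apply: HM; rewrite (lt_le_trans _ tM)// ltrDl.
have := orlicz_M_ge t0 s0; case: (orlicz_M Phi t) => [r| |]//.
  rewrite lee_fin ler_pdivrMr ?fine_orlicz_gt0// => /le_trans rF pr; apply: rF.
  rewrite ler_wpM2r ?fine_orlicz_ge0 ?(ltW s0)//.
  have [r0|r0] := leP r 0; first by rewrite (le_trans r0)// powR_ge0.
  apply: ln_le_powR => //; first exact: ltW.
  move: pr; rewrite lne_EFin// inver gt_eqF// -EFinM lte_fin.
  by rewrite ltr_pdivrMr// => /ltW.
by move=> _; rewrite inver gt_eqF// [lne _]/= gt0_mulye// lte_fin invr_gt0.
Qed.

(** On []e, B]] the power [x^p] stays above [e^p], so monotonicity and the scaling bound for the
    fixed factor [B] cost only the constant [c / e^p]. *)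
Lemma orlicz_growth_below (p B : R) : 0 < p -> 0 < B ->
  (exists2 e : R, 0 < e < 1 &
    forall t s, 0 < t <= e -> 0 < s -> F (t * s) <= t `^ p * F s) ->
  exists2 k : R, 0 <= k & forall x a, 0 < x <= B -> 0 < a ->
    F (x * a) <= k * x `^ p * F a.
Proof.
move=> p0 B0 [e /andP[e0 _] He]; have [c c0 Hc] := fine_orlicz_scale (ltW B0).
have ep0 : 0 < e `^ p by exact: powR_gt0.
exists (1 + c / e `^ p) => [|x a /andP[x0 xB] a0].
  by rewrite addr_ge0// divr_ge0// ltW.
have Fa := fine_orlicz_gt0 a0; have xp := powR_gt0 p x0.
have cx : 0 <= c / e `^ p * x `^ p by rewrite mulr_ge0 ?divr_ge0// ltW.
rewrite mulrDl mul1r; have [xe|ex] := leP x e.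
  by rewrite (le_trans (He x a _ a0)) ?x0// ler_wpM2r ?(ltW Fa)// lerDl.
apply: (@le_trans _ _ (F (B * a))).
  apply: fine_orlicz_le; first by rewrite mulr_ge0 ?(ltW x0) ?(ltW a0).
  by rewrite ler_wpM2r ?(ltW a0).
apply: (le_trans (Hc a (ltW a0))); rewrite ler_wpM2r ?(ltW Fa)//.
apply: (@le_trans _ _ (c / e `^ p * x `^ p)); last by rewrite lerDr ltW.
rewrite -mulrA ler_peMr ?(ltW c0)// mulrC ler_pdivlMr// mul1r.
by apply: ge0_ler_powR; rewrite ?nnegrE ?(ltW e0) ?(ltW x0) ?(ltW ex) ?(ltW p0).
Qed.

Lemma orlicz_growth_above (q b : R) : 0 < q -> 0 < b ->
  (exists2 X : R, 1 < X &
    forall t s, X <= t -> 0 < s -> F (t * s) <= t `^ q * F s) ->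
  exists2 k : R, 0 <= k & forall x a, b <= x -> 0 < a ->
    F (x * a) <= k * x `^ q * F a.
Proof.
move=> q0 b0 [X X1 HX].
have X0 : 0 < X by exact: lt_trans X1.
have [c c0 Hc] := fine_orlicz_scale (ltW X0).
have bq0 : 0 < b `^ q by exact: powR_gt0.
exists (1 + c / b `^ q) => [|x a bx a0].
  by rewrite addr_ge0// divr_ge0// ltW.
have x0 : 0 < x by exact: lt_le_trans bx.
have Fa := fine_orlicz_gt0 a0; have xq := powR_gt0 q x0.
have cx : 0 <= c / b `^ q * x `^ q by rewrite mulr_ge0 ?divr_ge0// ltW.
rewrite mulrDl mul1r; have [Xx|xX] := leP X x.
  by rewrite (le_trans (HX x a Xx a0))// ler_wpM2r ?(ltW Fa)// lerDl.
apply: (@le_trans _ _ (F (X * a))).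
  apply: fine_orlicz_le; first by rewrite mulr_ge0 ?(ltW x0) ?(ltW a0).
  by rewrite ler_wpM2r ?(ltW a0) ?(ltW xX).
apply: (le_trans (Hc a (ltW a0))); rewrite ler_wpM2r ?(ltW Fa)//.
apply: (@le_trans _ _ (c / b `^ q * x `^ q)); last by rewrite lerDr ltW.
rewrite -mulrA ler_peMr ?(ltW c0)// mulrC ler_pdivlMr// mul1r.
by apply: ge0_ler_powR; rewrite ?nnegrE ?(ltW b0) ?(ltW x0) ?(ltW q0).
Qed.

(** Keeps the terms of a two-sided geometric sequence that are at most 1, whose sum is bounded
    whatever the starting point. *)
Definition clamp (z : R) : R := if z <= 1 then z else 0.

Lemma clamp_ge0 z : 0 <= z -> 0 <= clamp z.
Proof. by move=> z0; rewrite /clamp; case: ifP. Qed.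

(* [clamp z * (1 - r)] is dominated by the telescoping
   [min z 1 - min (r * z) 1]. *)
Lemma sum_clamp_geometric (Z : nat -> R) (r : R) n : 0 < r < 1 ->
  (forall k, 0 < Z k) ->
  (forall k, Z k.+1 = r * Z k) \/ (forall k, Z k = r * Z k.+1) ->
  \sum_(0 <= k < n) clamp (Z k) <= (1 - r)^-1.
Proof.
move=> /andP[r0 r1] Z0 HZ; have d0 : 0 < 1 - r by rewrite subr_gt0.
rewrite -[leRHS]mul1r ler_pdivlMr// mulr_suml.
have tele k : clamp (Z k) * (1 - r) <= Num.min (Z k) 1 - Num.min (r * Z k) 1.
  rewrite /clamp; have [z1|z1] := leP (Z k) 1.
    have rz1 : r * Z k <= 1 by rewrite (le_trans _ z1)// ler_piMl ?ltW.
    by rewrite !min_l// mulrBr mulr1 mulrC.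
  by rewrite mul0r subr_ge0 ge_min lexx orbT.
have min0 k : 0 <= Num.min (r * Z k) 1 by rewrite le_min ler01 mulr_ge0 ?ltW.
apply: (le_trans (ler_sum_nat (fun k _ => tele k))).
case: HZ => HZ.
  rewrite (eq_bigr (fun k => - (Num.min (Z k.+1) 1 - Num.min (Z k) 1))).
    rewrite sumrN telescope_sumr// opprB lerBlDr; apply: ler_wpDr.
      by rewrite le_min ler01 ltW.
    by rewrite ge_min lexx orbT.
  by move=> k _; rewrite opprB HZ.
rewrite (eq_bigr (fun k => Num.min (r * Z k.+1) 1 - Num.min (r * Z k) 1)).
  rewrite telescope_sumr// lerBlDr; apply: ler_wpDr; first exact: min0.
  by rewrite ge_min lexx orbT.
by move=> k _; rewrite -HZ.
Qed.

End orlicz_growth.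

(** * The pointwise dyadic estimate and its integral *)

Section orlicz_modular.
Context {R : realType} {Phi : R -> \bar R}.
Hypothesis oPhi : orlicz_function Phi.
Hypothesis d2Phi : Delta2 Phi.

Let F (x : R) := fine (Phi x).

Let F0 x : 0 < x -> 0 < F x. Proof. exact: fine_orlicz_gt0. Qed.

(** With [z = Y / (D a) < 1], growth below gives [F (2 Y) <= k (2 D z)^p' F a], while [marc_hi]
    contributes [z^(-p)]; the surplus [z^(p' - p)] is summable over dyadic [Y]. The lower half below
    uses [z = D a / Y] and leaves [z^(q - q')]. *)
Lemma orlicz_marc_hi_le (p D : R) : 0 < p -> 0 < D ->
  (p%:E < orlicz_lower Phi)%E ->
  exists2 k : R, 0 <= k & exists2 d : R, 0 < d & forall Y a, 0 < Y -> 0 < a ->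
    F (2 * Y) * marc_hi p (D * a / Y) <= k * clamp ((Y / (D * a)) `^ d) * F a.
Proof.
move=> p0 D0 /(orlicz_lower_growth oPhi d2Phi p0)[p' pp' gr].
have p'0 : 0 < p' := lt_trans p0 pp'.
have D20 : 0 < 2 * D by rewrite mulr_gt0.
have [k k0 Hk] := orlicz_growth_below oPhi d2Phi p'0 D20 gr.
exists (k * (2 * D) `^ p'); first by rewrite mulr_ge0 ?powR_ge0.
exists (p' - p) => [|Y a Y0 a0]; first by rewrite subr_gt0.
have Da0 : 0 < D * a by rewrite mulr_gt0.
pose z := Y / (D * a); have z0 : 0 < z by rewrite divr_gt0.
have zn0 : z != 0 by rewrite gt_eqF.
have Fa := F0 a0.
rewrite -/z /marc_hi; case: ltP => z1; last first.
  by rewrite mulr0 mulr_ge0 ?(ltW Fa)// mulr_ge0 ?clamp_ge0 ?powR_ge0// mulr_ge0 ?powR_ge0.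
have zV : D * a / Y = z^-1 by rewrite /z invf_div.
have zle1 : z < 1 by move: z1; rewrite zV invf_gt1.
have -> : 2 * Y = (2 * D * z) * a by rewrite /z; field; rewrite !gt_eqF.
have := Hk (2 * D * z) a; rewrite mulr_gt0//= ler_piMr ?(ltW zle1) ?(ltW D20)//.
move=> /(_ isT a0) FY.
have zd1 : z `^ (p' - p) <= 1.
  by rewrite -[leRHS](powRr0 z) ger_powR ?subr_ge0 ?(ltW pp')// z0 ltW.
apply: (@le_trans _ _ (k * (2 * D * z) `^ p' * F a * (D * a / Y) `^ p)).
  by rewrite ler_wpM2r ?powR_ge0.
rewrite /clamp zd1 zV -powR_inv1 ?(ltW z0)// -powRrM mulN1r.
rewrite powRM ?(ltW z0) ?(ltW D20)// powRD; last by rewrite zn0 implybT.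
by rewrite le_eqVlt; apply/orP; left; apply/eqP; ring.
Qed.

Lemma orlicz_marc_lo_le (q D : R) : 0 < D -> (0 < orlicz_upper Phi)%E ->
  (orlicz_upper Phi < q%:E)%E ->
  exists2 k : R, 0 <= k & exists2 d : R, 0 < d & forall Y a, 0 < Y -> 0 < a ->
    F (2 * Y) * marc_lo q%:E (D * a / Y) <= k * clamp ((D * a / Y) `^ d) * F a.
Proof.
move=> D0 u0 /(orlicz_upper_growth oPhi d2Phi u0)[q' /andP[q'0 q'q] gr].
have D20 : 0 < 2 * D by rewrite mulr_gt0.
have [k k0 Hk] := orlicz_growth_above oPhi d2Phi q'0 D20 gr.
exists (k * (2 * D) `^ q'); first by rewrite mulr_ge0 ?powR_ge0.
exists (q - q') => [|Y a Y0 a0]; first by rewrite subr_gt0.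
have Da0 : 0 < D * a by rewrite mulr_gt0.
pose z := D * a / Y; have z0 : 0 < z by rewrite divr_gt0.
have zn0 : z != 0 by rewrite gt_eqF.
have Fa := F0 a0.
rewrite -/z /marc_lo; case: ltP => z1.
  by rewrite mulr0 mulr_ge0 ?(ltW Fa)// mulr_ge0 ?clamp_ge0 ?powR_ge0// mulr_ge0 ?powR_ge0.
have -> : 2 * Y = (2 * D * z^-1) * a by rewrite /z; field; rewrite !gt_eqF.
have zi : 1 <= z^-1 by rewrite invf_ge1.
have := Hk (2 * D * z^-1) a; rewrite ler_peMr ?(ltW D20)//.
move=> /(_ isT a0) FY.
have zd1 : z `^ (q - q') <= 1.
  by rewrite -[leRHS](powRr0 z) ger_powR ?subr_ge0 ?(ltW q'q)// z0.
apply: (@le_trans _ _ (k * (2 * D * z^-1) `^ q' * F a * z `^ q)).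
  by rewrite ler_wpM2r ?powR_ge0.
rewrite /clamp zd1 powRM ?invr_ge0 ?(ltW z0) ?(ltW D20)//.
rewrite -powR_inv1 ?(ltW z0)// -powRrM mulN1r.
rewrite [_ `^ (q - q')]powRD; last by rewrite zn0 implybT.
by rewrite le_eqVlt; apply/orP; left; apply/eqP; ring.
Qed.

(** Allows both orientations, so that positive and negative powers of 2 are handled by sequences
    indexed by [nat]. *)
Definition dyadic (Y : nat -> R) :=
  (forall n, 0 < Y n) /\
  ((forall n, Y n.+1 = 2 * Y n) \/ (forall n, Y n = 2 * Y n.+1)).

Lemma sum_clamp_dyadic (d : R) : 0 < d -> exists2 k : R, 0 <= k &
  forall Y b n, dyadic Y -> 0 < b ->
  \sum_(0 <= i < n) clamp ((Y i / b) `^ d) <= k /\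
  \sum_(0 <= i < n) clamp ((b / Y i) `^ d) <= k.
Proof.
move=> d0; pose r : R := 2^-1 `^ d.
have i0 : 0 < 2^-1 :> R by rewrite invr_gt0.
have r0 : 0 < r by exact: powR_gt0.
have r1 : r < 1.
  have <- : 1 `^ d = 1 :> R by rewrite powR1.
  by rewrite gt0_ltr_powR ?nnegrE ?(ltW i0)// invf_lt1// ltr1n.
exists (1 - r)^-1 => [|Y b n [Y0 HY] b0]; first by rewrite invr_ge0 subr_ge0 ltW.
have Yb0 i : 0 <= Y i / b by rewrite divr_ge0// ltW.
have bY0 i : 0 <= b / Y i by rewrite divr_ge0// ltW.
split; (apply: sum_clamp_geometric;
  [by rewrite r0|by move=> i; rewrite powR_gt0// divr_gt0|]).
  case: HY => HY; [right|left] => i; rewrite /r -powRM ?(ltW i0)// (HY i); congr (_ `^ _).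
    by field; rewrite gt_eqF.
  by field; rewrite gt_eqF.
case: HY => HY; [left|right] => i; rewrite /r -powRM ?(ltW i0)// (HY i); congr (_ `^ _).
  by field; rewrite gt_eqF.
by field; rewrite gt_eqF.
Qed.

(** The constant does not depend on [Y]: the bound is used for the powers of 2 on either side of 1,
    and for a sequence starting at an arbitrary level. *)
Lemma orlicz_marc_sum_le (p D : R) (q : \bar R) : 0 < p -> 0 < D ->
  [/\ (p%:E < orlicz_lower Phi)%E, (orlicz_lower Phi <= orlicz_upper Phi)%E,
      (orlicz_upper Phi < q)%E & (q < +oo)%E]
  \/ ((p%:E < orlicz_lower Phi)%E /\ q = +oo%E) ->
  exists2 k : R, 0 <= k & forall Y a n, dyadic Y -> 0 <= a ->
    \sum_(0 <= i < n) F (2 * Y i) * marc p q (D * a / Y i) <= k * F a.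
Proof.
move=> p0 D0 index.
have pP : (p%:E < orlicz_lower Phi)%E by case: index => -[].
have [k1 k10 [d1 d10 H1]] := orlicz_marc_hi_le p0 D0 pP.
have [k2 k20 [d2 d20 [H2 q0]]] : exists2 k : R, 0 <= k & exists2 d : R, 0 < d &
    (forall Y a, 0 < Y -> 0 < a ->
      F (2 * Y) * marc_lo q (D * a / Y) <= k * clamp ((D * a / Y) `^ d) * F a) /\
    marc_lo q 0 = 0.
  case: index => [[_ lu uq qy]|[_ ->]]; last first.
    exists 0 => //; exists 1 => //; split => [Y a _ _|].
      by rewrite /marc_lo; case: ifP => _; rewrite mulr0 !mul0r.
    by rewrite /marc_lo; case: ifP.
  have u0 : (0 < orlicz_upper Phi)%E.
    by apply: lt_le_trans lu; apply: lt_trans pP; rewrite lte_fin.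
  case: q uq qy => [q' | |] uq qy; [|by []|by move: uq; rewrite ltNge leNye].
  have [k k0 [d d0 H]] := orlicz_marc_lo_le D0 u0 uq.
  exists k => //; exists d => //; split => //.
  rewrite /marc_lo ltr10 powR0// gt_eqF//.
  by have := lt_trans u0 uq; rewrite lte_fin.
have [s1 s10 S1] := sum_clamp_dyadic d10; have [s2 s20 S2] := sum_clamp_dyadic d20.
exists (k1 * s1 + k2 * s2) => [|Y a n dY].
  by rewrite addr_ge0// mulr_ge0.
have Y0 := dY.1.
rewrite le_eqVlt => /predU1P[<-|a0].
  rewrite big1 => [|i _].
    by rewrite mulr_ge0 ?addr_ge0 ?mulr_ge0// fine_orlicz_ge0.
  by rewrite mulr0 mul0r /marc /marc_hi ltr10 q0 addr0 mulr0.
have Fa := ltW (F0 a0); have Da0 : 0 < D * a by rewrite mulr_gt0.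
rewrite (eq_bigr (fun i => F (2 * Y i) * marc_hi p (D * a / Y i) +
  F (2 * Y i) * marc_lo q (D * a / Y i))); last by move=> i _; rewrite /marc mulrDr.
rewrite big_split/= mulrDl; apply: lerD.
  apply: (@le_trans _ _ (\sum_(0 <= i < n) k1 * clamp ((Y i / (D * a)) `^ d1) * F a)).
    by apply: ler_sum => i _; exact: H1.
  rewrite -mulr_suml ler_wpM2r// -mulr_sumr ler_wpM2l//.
  exact: (S1 _ _ _ dY Da0).1.
apply: (@le_trans _ _ (\sum_(0 <= i < n) k2 * clamp ((D * a / Y i) `^ d2) * F a)).
  by apply: ler_sum => i _; exact: H2.
rewrite -mulr_suml ler_wpM2r// -mulr_sumr ler_wpM2l//.
exact: (S2 _ _ _ dY Da0).2.
Qed.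

Lemma measurable_orlicz (f : R -> R) : measurable_fun setT f -> nonneg f ->
  measurable_fun setT (fun x => Phi (f x)).
Proof.
move=> mf f0.
have -> : (fun x => Phi (f x)) = (fun x => (F (Num.max (f x) 0))%:E).
  by apply/funext => x; rewrite max_l// (orlicz_fineE oPhi d2Phi).
have mG : measurable_fun setT (fun y : R => F (Num.max y 0)).
  apply: nondecreasing_measurable => // x y xy.
  apply: fine_orlicz_le => //; first by rewrite le_max lexx orbT.
  by rewrite ge_max !le_max xy lexx orbT.
by apply/measurable_EFinP; exact: (measurableT_comp mG mf).
Qed.

Lemma dyadic_layers_le (p D k : R) (q : \bar R) (Y : nat -> R) (f : R -> R)
    (e : nat -> \bar R) : 0 < D ->
  (forall Y a n, dyadic Y -> 0 <= a ->
    \sum_(0 <= i < n) F (2 * Y i) * marc p q (D * a / Y i) <= k * F a) ->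
  0 <= k -> dyadic Y -> measurable_fun setT f -> nonneg f ->
  (forall n, 0 <= e n <= \int[leb_pos]_x (marc p q (D * f x / Y n))%:E)%E ->
  (\sum_(n <oo) (F (2 * Y n))%:E * e n <= k%:E * \int[leb_pos]_x Phi (f x))%E.
Proof.
move=> D0 Hk k0 dY mf f0 he; have Y0 := dY.1.
have FY n : 0 <= F (2 * Y n) by rewrite ltW// F0// mulr_gt0.
have mPf := measurable_orlicz mf f0.
have mm n : measurable_fun setT (fun x => (marc p q (D * f x / Y n))%:E).
  apply/measurable_EFinP; apply: (measurableT_comp (measurable_marc p q)).
  by apply: measurable_funM => //; exact: measurable_funM.
have t0 n x : (0 <= (F (2 * Y n))%:E * (marc p q (D * f x / Y n))%:E)%E.
  by rewrite -EFinM lee_fin mulr_ge0// marc_ge0.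
have msum : measurable_fun setT (fun x => \sum_(n <oo)
    ((F (2 * Y n))%:E * (marc p q (D * f x / Y n))%:E))%E.
  apply: ge0_emeasurable_sum => [n x _ _|n _]; first exact: t0.
  by apply: emeasurable_funM => //; exact: mm.
have mt n : measurable_fun setT (fun x =>
    ((F (2 * Y n))%:E * (marc p q (D * f x / Y n))%:E)%E).
  by apply: emeasurable_funM => //; exact: mm.
apply: (@le_trans _ _ (\int[leb_pos]_x (\sum_(n <oo)
    ((F (2 * Y n))%:E * (marc p q (D * f x / Y n))%:E)))%E).
  rewrite integral_nneseries//; apply: lee_nneseries => [n _ _|n _].
    by rewrite mule_ge0 ?lee_fin//; case/andP: (he n).
  rewrite ge0_integralZl//.
  - by apply: lee_wpmul2l; [rewrite lee_fin|case/andP: (he n)].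
  - exact: mm.
  - by move=> x _; rewrite lee_fin marc_ge0.
  - by rewrite lee_fin.
have PE : (\int[leb_pos]_x (k%:E * Phi (f x)) = k%:E * \int[leb_pos]_x Phi (f x))%E.
  by rewrite ge0_integralZl// => x _; exact: (orlicz_ge0 oPhi).
rewrite -PE; apply: ge0_le_integral => //.
- by move=> x _; exact: nneseries_ge0.
- by apply: emeasurable_funM => //; exact: mPf.
move=> x _; apply: lime_le; first exact: is_cvg_nneseries.
apply: nearW => n; rewrite (orlicz_fineE oPhi d2Phi (f0 x)) -EFinM.
under eq_bigr do rewrite -EFinM.
by rewrite sumEFin lee_fin; exact: Hk.
Qed.

End orlicz_modular.

(** * Interpolation for the Orlicz modular *)

Section orlicz_interpolation.
Context {R : realType} {Phi : R -> \bar R}.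
Hypothesis oPhi : orlicz_function Phi.
Hypothesis d2Phi : Delta2 Phi.

Let F (x : R) := fine (Phi x).

(** [up] starts at 1 and [down] at 1/2: together they list each integer power of 2 once. *)
Let up (n : nat) : R := 2 ^+ n.
Let down (n : nat) : R := 2^-1 ^+ n.+1.

Let dyadic_up : dyadic up.
Proof. by split => [n|]; [rewrite /up exprn_gt0|left => n; rewrite /up exprS]. Qed.

Let dyadic_down : dyadic down.
Proof.
split=> [n|]; first by rewrite /down exprn_gt0 ?invr_gt0.
by right => n; rewrite /down [in RHS]exprS mulrA divff ?mul1r.
Qed.

(** If [Y < |g| <= 2 Y] for a power [Y] of 2, the single layer at [Y], of height [F (2 Y)], already
    dominates [Phi |g|]. *)
Lemma orlicz_integral_le_distr (g : R -> R) : measurable_fun setT g ->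
  (\int[leb_pos]_x Phi `|g x|%R <=
   \sum_(n <oo) (F (2 * up n))%:E * distr leb_pos g (up n) +
   \sum_(n <oo) (F (2 * down n))%:E * distr leb_pos g (down n))%E.
Proof.
move=> mg; have Fu n : 0 <= F (2 * up n).
  by apply: fine_orlicz_ge0 => //; rewrite mulr_ge0// ltW// dyadic_up.1.
have Fd n : 0 <= F (2 * down n).
  by apply: fine_orlicz_ge0 => //; rewrite mulr_ge0// ltW// dyadic_down.1.
pose lu := layers g up (fun n => F (2 * up n)).
pose ld := layers g down (fun n => F (2 * down n)).
have mlu : measurable_fun setT lu by exact: measurable_layers.
have mld : measurable_fun setT ld by exact: measurable_layers.
have lu0 x : (0 <= lu x)%E by exact: layers_ge0.
have ld0 x : (0 <= ld x)%E by exact: layers_ge0.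
rewrite -!integral_layers// -ge0_integralD//.
apply: ge0_le_integral => //.
- by move=> x _; exact: (orlicz_ge0 oPhi).
- apply: (measurable_orlicz oPhi d2Phi) => //; exact: measurableT_comp.
- exact: emeasurable_funD.
move=> x _; have := normr_ge0 (g x); rewrite le_eqVlt => /predU1P[<-|gx0].
  by rewrite (orlicz_0 oPhi) adde_ge0.
have [g1|g1] := ltP 1 `|g x|.
  have [n /andP[ng gn]] := exprn_bracket_oc (ltr1n R 2) g1.
  apply: (@le_trans _ _ (lu x)); last by rewrite leeDl//; exact: ld0.
  apply: (@le_trans _ _ (F (2 * up n))%:E); last exact: layers_ge.
  rewrite (orlicz_fineE oPhi d2Phi)// lee_fin.
  by apply: fine_orlicz_le => //; rewrite /up -exprS.
have gi1 : 1 <= `|g x|^-1 by rewrite invf_ge1.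
have [n /andP[ng gn]] := exprn_bracket_co (ltr1n R 2) gi1.
apply: (@le_trans _ _ (ld x)); last by rewrite leeDr//; exact: lu0.
apply: (@le_trans _ _ (F (2 * down n))%:E); last first.
  apply: layers_ge => //.
  by rewrite /down exprVn invf_plt ?posrE ?exprn_gt0.
rewrite (orlicz_fineE oPhi d2Phi)// lee_fin.
apply: fine_orlicz_le => //; rewrite /down exprS mulrA divff// mul1r exprVn.
by rewrite invf_pge ?posrE ?exprn_gt0.
Qed.

Lemma orlicz_interpolation (p Cp Cq : R) (q : \bar R) : 0 < p -> (p%:E < q)%E ->
  [/\ (p%:E < orlicz_lower Phi)%E, (orlicz_lower Phi <= orlicz_upper Phi)%E,
      (orlicz_upper Phi < q)%E & (q < +oo)%E]
  \/ ((p%:E < orlicz_lower Phi)%E /\ q = +oo%E) ->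
  exists K : R, forall T : (R -> R) -> (R -> R),
    operator_on leb_pos (sum_cone leb_pos p%:E q) T ->
    subconvex leb_pos (sum_cone leb_pos p%:E q) (fun f x => `|T f x|) ->
    weak_type leb_pos p%:E Cp T ->
    weak_type leb_pos q Cq T ->
    forall f : R -> R, orlicz_space Phi f -> nonneg f ->
      (\int[leb_pos]_x Phi `|T f x|%R <= K%:E * \int[leb_pos]_x Phi (f x))%E.
Proof.
move=> p0 pq index.
(* [K] must be fixed before [T], when no sign of [Cp] or [Cq] is known yet; the 1 keeps [C]
   positive. *)
pose C := Num.max 1 (Num.max Cp Cq).
have C0 : 0 < C by rewrite lt_max ltr01.
have CpC : Cp <= C by rewrite !le_max lexx orbT.
have CqC : Cq <= C by rewrite !le_max lexx !orbT.
have D0 : 0 < 2 * C by rewrite mulr_gt0.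
have [k k0 Hk] := orlicz_marc_sum_le oPhi d2Phi p0 D0 index.
(* One [k] for each of the sequences [up] and [down]; the 1 makes the constant positive, so that the
   right side is [+oo] when the modular of [f] is. *)
exists (k + k + 1) => T opT scT wp wq f [[mf _] _] f0.
set I := (\int[leb_pos]_x Phi (f x))%E.
have I0 : (0 <= I)%E by apply: integral_ge0 => x _; exact: (orlicz_ge0 oPhi).
have k1 : 0 < k + k + 1 by rewrite ltr_pwDr// addr_ge0.
have [Iy|] := eqVneq I +oo%E; first by rewrite Iy gt0_muley ?leey// lte_fin.
rewrite -ltey => Ioo.
have mPf := measurable_orlicz oPhi d2Phi mf f0.
have mm Y : measurable_fun setT (fun x => (marc p q (2 * C * f x / Y))%:E).
  apply/measurable_EFinP; apply: (measurableT_comp (measurable_marc p q)).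
  by apply: measurable_funM => //; exact: measurable_funM.
(* One term of the pointwise bound, for the dyadic sequence that starts at [Y], bounds the integrand
   by a multiple of [Phi (f x)]. *)
have fin Y : 0 < Y -> (\int[leb_pos]_x (marc p q (2 * C * f x / Y))%:E < +oo)%E.
  move=> Y0; have FY : 0 < F (2 * Y) by apply: fine_orlicz_gt0 => //; rewrite mulr_gt0.
  apply: (@le_lt_trans _ _ (\int[leb_pos]_x ((k / F (2 * Y))%:E * Phi (f x)))%E).
    apply: ge0_le_integral => //.
    - by move=> x _; rewrite lee_fin marc_ge0.
    - exact: mm.
    - by apply: emeasurable_funM => //; exact: mPf.
    move=> x _; rewrite (orlicz_fineE oPhi d2Phi (f0 x)) -EFinM lee_fin.
    have dY : dyadic (fun n => 2 ^+ n * Y).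
      split => [n|]; first by rewrite mulr_gt0// exprn_gt0.
      by left => n; rewrite exprS mulrA.
    have := Hk _ (f x) 1%N dY (f0 x).
    rewrite big_nat1 expr0 mul1r => H.
    by rewrite [leRHS]mulrAC ler_pdivlMr// mulrC.
  rewrite ge0_integralZl//.
  - by rewrite lte_mul_pinfty// lee_fin divr_ge0// ltW.
  - by move=> x _; exact: (orlicz_ge0 oPhi).
  - by rewrite lee_fin divr_ge0// ltW.
have split Y : 0 < Y -> sum_cone leb_pos p%:E q f /\
    (0 <= distr leb_pos (T f) Y <=
     \int[leb_pos]_x (marc p q (2 * C * f x / Y))%:E)%E.
  move=> Y0; rewrite distr_ge0/=; have := fin Y Y0.
  have -> : (\int[leb_pos]_x (marc p q (2 * C * f x / Y))%:E =
      \int[leb_pos]_x (marc p q (f x / (Y / (2 * C))))%:E)%E.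
    by apply: eq_integral => x _; rewrite invf_div mulrCA mulrA.
  exact: (subconvex_distr_le p0 pq opT scT wp wq C0 CpC CqC).
have mT : measurable_fun setT (T f) by case: (opT.1 _ (split 1 ltr01).1).
have le_layers Y : dyadic Y ->
    (\sum_(n <oo) (F (2 * Y n))%:E * distr leb_pos (T f) (Y n) <= k%:E * I)%E.
  move=> dY; apply: (dyadic_layers_le oPhi d2Phi D0 Hk) => // n.
  exact: (split _ (dY.1 n)).2.
apply: (le_trans (orlicz_integral_le_distr mT)).
apply: (@le_trans _ _ (k%:E * I + k%:E * I)%E).
  by apply: leeD; exact: le_layers.
rewrite -ge0_muleDl ?lee_fin// -EFinD.
by apply: lee_wpmul2r => //; rewrite lee_fin lerDl.
Qed.

End orlicz_interpolation.

Theorem theorem3p11 (R : realType) (p q : \bar R) (Cp Cq : R)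
  (hp : (0 < p)%E) (hpq : (p <= q)%E) :
  (forall T : (R -> R) -> (R -> R),
     operator_on leb_pos (sum_cone leb_pos p q) T ->
     subconvex leb_pos (sum_cone leb_pos p q) T ->
     subconvex leb_pos (sum_cone leb_pos p q) (fun f x => `|T f x|) ->
     weak_type leb_pos p Cp T ->
     weak_type leb_pos q Cq T ->
     forall (E : set (R -> R)) (N : (R -> R) -> R),
       symmetric_quasi_banach E N ->
       [/\ (p < boyd_lower E N)%E, (boyd_lower E N <= boyd_upper E N)%E,
           (boyd_upper E N < q)%E & (q < +oo)%E]
       \/ ((p < boyd_lower E N)%E /\ q = +oo%E) ->
       forall f : R -> R, E f -> nonneg f ->
         E (T f) /\
         N (T f) <= 2 * Theta_norm p q E N * Num.max Cp Cq * N f)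
  /\
  (forall Phi : R -> \bar R,
     orlicz_function Phi -> Delta2 Phi ->
     [/\ (p < orlicz_lower Phi)%E, (orlicz_lower Phi <= orlicz_upper Phi)%E,
         (orlicz_upper Phi < q)%E & (q < +oo)%E]
     \/ ((p < orlicz_lower Phi)%E /\ q = +oo%E) ->
     exists K : R, forall T : (R -> R) -> (R -> R),
       operator_on leb_pos (sum_cone leb_pos p q) T ->
       subconvex leb_pos (sum_cone leb_pos p q) T ->
       subconvex leb_pos (sum_cone leb_pos p q) (fun f x => `|T f x|) ->
       weak_type leb_pos p Cp T ->
       weak_type leb_pos q Cq T ->
       forall f : R -> R, orlicz_space Phi f -> nonneg f ->
         (\int[leb_pos]_x Phi `|T f x|%R <=
          K%:E * \int[leb_pos]_x Phi (f x))%E).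
Proof.
(* Either index condition forces [p] to be finite and [p < q], the setting of the preceding
   results. *)
have pltq (l u : \bar R) : [/\ (p < l)%E, (l <= u)%E, (u < q)%E & (q < +oo)%E] \/
    (p < l)%E /\ q = +oo%E -> p \is a fin_num /\ (p < q)%E.
  have pfin x : (p < x)%E -> p \is a fin_num.
    by move=> px; rewrite ge0_fin_numE ?ltW// (lt_le_trans px)// leey.
  case=> [[pl lu uq _]|[pl ->]].
    by split; [exact: pfin pl|exact: lt_trans (lt_le_trans pl lu) uq].
  by split; [exact: pfin pl|rewrite (lt_le_trans pl)// leey].
split => [T opT _ scT wp wq E N EN index f Ef f0|Phi oPhi d2Phi index].
  have [/fineK pE pq] := pltq _ _ index.
  move: hp opT scT wp index pq; rewrite -pE lte_fin => p0 opT scT wp index pq.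
  exact: (interpolation EN p0 pq opT scT wp wq index).
have [/fineK pE pq] := pltq _ _ index.
move: hp index pq; rewrite -pE lte_fin => p0 index pq.
have [K HK] := orlicz_interpolation oPhi d2Phi Cp Cq p0 pq index.
by exists K => T opT _ scT wp wq; exact: HK.
Qed.
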